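(* The Maximum Connectivity Improvement (MCI) problem on DAGs is fixed-parameter tractable with respect to $|S|+|T|$.
   Context: For a directed graph $G=(V,E)$ let $f(G)$ be the number of ordered pairs $(v,u)\in V\times V$ such that there is a directed path from $v$ to $u$ in $G$ (each vertex reaches itself). For a set $N$ of ordered pairs, $G(N)=(V,E\cup N)$. MCI: given a DAG $G=(V,E)$ and an integer $B\ge 0$, find $N\subseteq (V\times V)\setminus E$ with $|N|\le B$ maximizing $f(G(N))$. In the input DAG, a source is a vertex with no incoming and at least one outgoing edge ($S$ = set of sources), a sink is a vertex with no outgoing and at least one incoming edge ($T$ = set of sinks). FPT with respect to a parameter $k$ means solvable exactly in time $g(k)\cdot |V|^{O(1)}$ for some computable $g$. *)

(* Defs.v *)
From mathcomp Require Import all_boot.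

Set Implicit Arguments.
Unset Strict Implicit.
Unset Printing Implicit Defensive.

Section Digraph.
Variable V : finType.
Implicit Types E N : {set V * V}.

Definition adj E : rel V := fun v u => (v, u) \in E.

(* [connect] is the reflexive-transitive closure: paths of length 0 count. *)
Definition connectivity E : nat :=
  #|[set p : V * V | connect (adj E) p.1 p.2]|.

(* A closed directed walk is a nonempty list satisfying [cycle]; this also
   rules out loops. *)
Definition acyclic E : Prop := forall c : seq V, cycle (adj E) c -> c = [::].

(* Isolated vertices are neither sources nor sinks. *)
Definition sources E : {set V} :=
  [set v | [forall u, ~~ adj E u v] && [exists u, adj E v u]].

Definition sinks E : {set V} :=
  [set v | [forall u, ~~ adj E v u] && [exists u, adj E u v]].

Definition feasible E (B : nat) N : Prop := N \subset ~: E /\ #|N| <= B.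

Definition mci_optimal E (B : nat) N : Prop :=
  feasible E B N /\
  forall N', feasible E B N' ->
    connectivity (E :|: N') <= connectivity (E :|: N).

End Digraph.

Record mci_instance := MCIInstance {
  nb_vertices : nat;
  edges : {set 'I_nb_vertices * 'I_nb_vertices};
  edges_acyclic : acyclic edges;
  budget : nat }.

(* Structured programs for a RAM with registers and an indirectly addressable
   memory, both holding natural numbers, and unit cost per operation.  The only
   arithmetic is addition and truncated subtraction: with unit-cost
   multiplication the machine would no longer be polynomially equivalent to
   Turing machines, whereas here t steps lengthen a number by at most O(t)
   bits. *)

Inductive expr :=
  | Lit of nat
  | Reg of nat
  | Mem of expr
  | Add of expr & expr
  | Sub of expr & expr.

Inductive cmd :=
  | Skip
  | Assign of nat & expr
  | Store of expr & expr
  | Seq of cmd & cmd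
  | If of expr & cmd & cmd
  | While of expr & cmd.

Record state := State { reg : nat -> nat; memory : nat -> nat }.

Definition upd (m : nat -> nat) (a v : nat) : nat -> nat :=
  fun b => if b == a then v else m b.

Fixpoint eval (s : state) (e : expr) : nat :=
  match e with
  | Lit v => v
  | Reg r => reg s r
  | Mem a => memory s (eval s a)
  | Add e1 e2 => eval s e1 + eval s e2
  | Sub e1 e2 => eval s e1 - eval s e2
  end.

Fixpoint cost (e : expr) : nat :=
  match e with
  | Lit _ | Reg _ => 1
  | Mem a => (cost a).+1
  | Add e1 e2 | Sub e1 e2 => (cost e1 + cost e2).+1
  end.

(* [exec c s t s']: started in [s], the program [c] halts after [t] steps in
   [s'].  Tests succeed on nonzero values.  The relation is functional in
   [(c, s)], so the existence of a run expresses termination. *)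
Inductive exec : cmd -> state -> nat -> state -> Prop :=
  | ExecSkip s : exec Skip s 1 s
  | ExecAssign s r e :
      exec (Assign r e) s (cost e).+1 (State (upd (reg s) r (eval s e)) (memory s))
  | ExecStore s a e :
      exec (Store a e) s (cost a + cost e).+1
        (State (reg s) (upd (memory s) (eval s a) (eval s e)))
  | ExecSeq c1 c2 s s1 s2 t1 t2 :
      exec c1 s t1 s1 -> exec c2 s1 t2 s2 -> exec (Seq c1 c2) s (t1 + t2) s2
  | ExecIfTrue e c1 c2 s s' t :
      eval s e != 0 -> exec c1 s t s' -> exec (If e c1 c2) s (cost e + t).+1 s'
  | ExecIfFalse e c1 c2 s s' t :
      eval s e = 0 -> exec c2 s t s' -> exec (If e c1 c2) s (cost e + t).+1 s'
  | ExecWhileTrue e c s s1 s2 t1 t2 :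
      eval s e != 0 -> exec c s t1 s1 -> exec (While e c) s1 t2 s2 ->
      exec (While e c) s (cost e + t1 + t2).+1 s2
  | ExecWhileFalse e c s :
      eval s e = 0 -> exec (While e c) s (cost e).+1 s.

Definition computable (g : nat -> nat) : Prop :=
  exists c : cmd, forall k : nat, exists t s',
    exec c (State (upd (fun=> 0) 0 k) (fun=> 0)) t s' /\ reg s' 0 = g k.

(* [encode x] is the initial state on the instance [x], and [solved x s] says
   that the final state [s] holds a correct answer.  The polynomial is taken in
   [(size x).+1] so that an instance of size 0 is granted a nonzero time; for
   positive sizes the factor [2 ^ d] this allows is absorbed by [g]. *)
Definition fpt (I : Type) (encode : I -> state) (size param : I -> nat)
    (solved : I -> state -> Prop) : Prop :=
  exists (c : cmd) (g : nat -> nat) (d : nat),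
    computable g /\
    forall x : I, exists t s',
      [/\ exec c (encode x) t s',
          t <= g (param x) * (size x).+1 ^ d &
          solved x s'].

(* Row-major position of an entry of an [n * n] matrix. *)
Definition cell (n : nat) (p : 'I_n * 'I_n) : nat := p.1 * n + p.2.

(* Register 0 holds the number of vertices, register 1 the budget, and the
   memory the adjacency matrix; everything else is 0. *)
Definition mci_encode (x : mci_instance) : state :=
  State (upd (upd (fun=> 0) 0 (nb_vertices x)) 1 (budget x))
        (fun a => nat_of_bool [exists p in edges x, cell p == a]).

(* The answer is left in memory as an adjacency matrix, any nonzero entry
   denoting an edge. *)
Definition mci_decode (n : nat) (s : state) : {set 'I_n * 'I_n} :=
  [set p | memory s (cell p) != 0].

Definition mci_solved (x : mci_instance) (s : state) : Prop :=
  mci_optimal (edges x) (budget x) (mci_decode (nb_vertices x) s).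

Definition mci_param (x : mci_instance) : nat :=
  #|sources (edges x)| + #|sinks (edges x)|.

(* Main.v *)
From mathcomp Require Import all_boot zify.
Require Import Defs.

(* An added edge (v, u) may be replaced by an edge from a sink reachable from v
   to a source reaching u, so if there were no isolated vertices one could try
   all the 2 ^ (|S| * |T|) sets of edges from T to S.  The number of isolated
   vertices is not bounded by the parameter, but in an optimal solution any two
   isolated vertices that are used are comparable for reachability: otherwise
   contracting the one related to fewer vertices saves an edge, which can be
   spent on inserting it next to the other, and this strictly increases the
   number of connected pairs.  Hence all the used ones except a best one, j, can
   be contracted, saving one edge each, and the saved edges pay for replacing j
   by a path on the same number of isolated vertices, whichever they are.  So
   some optimal solution consists of a path on the first few isolated vertices
   and of edges from T and the end of the path to S and the start of the path.
   There are at most (n + 1) * 2 ^ ((|S| + |T| + 1) ^ 2) such candidates, and the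
   program tries them all.

   All loops of the program have bounds that are fixed before they start, so it
   computes a total function and takes time polynomial in these bounds. *)

Set Implicit Arguments.
Unset Strict Implicit.
Unset Printing Implicit Defensive.

(** * Digraphs *)

Section Connect.
Variables (T T' : finType).
Implicit Types (e : rel T).

(** The best vertex [j] cannot be chosen by its number of connected pairs alone, because a pair of
    used isolated vertices belongs to both of them and all of them are replaced together. The score
    of a vertex is therefore twice its pairs with the non-isolated vertices plus its pairs with the
    used ones, so that the scores add up to twice the quantity to be compared. A path in place of
    the used vertices could still lose pairs if [j] reached some of them in both directions. For
    this reason every transformation also has to keep a closed walk through [j], which in the end
    makes the vertices of the new path mutually reachable.

    Redirecting edges to sinks and sources takes place between contraction and insertion, when [j]
    is the only isolated vertex that added edges may touch. It also makes the added edges disjoint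
    from [E] at no expense, since each leaves a vertex without outgoing edges in [E]. *)

Lemma connect_homo e (e' : rel T') (f : T -> T') :
  (forall x y, e x y -> connect e' (f x) (f y)) ->
  forall x y, connect e x y -> connect e' (f x) (f y).
Proof.
move=> fe x y /connectP[p]; elim: p x => [|z p IHp] x /= => [_ -> //|].
by case/andP=> /fe xz zp yl; apply: connect_trans xz (IHp _ zp yl).
Qed.

Lemma connect_first e x y :
  connect e x y -> x != y -> exists2 z, e x z & connect e z y.
Proof.
case/connectP=> [[|z p] /=]; first by move=> _ ->; rewrite eqxx.
by case/andP=> xz zp yl _; exists z => //; apply/connectP; exists p.
Qed.

Lemma connect_last e x y :
  connect e x y -> x != y -> exists2 z, e z y & connect e x z.
Proof.
case/connectP=> p; case/lastP: p => [|p z]; first by move=> _ /= ->; rewrite eqxx.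
rewrite rcons_path last_rcons => /andP[xp lz] -> _.
by exists (last x p) => //; apply/connectP; exists p.
Qed.

(** As [connect] is reflexive, it does not tell whether [j] lies on a closed walk of positive
    length; a loop at [j] is such a walk. *)
Definition oncycle e j := [exists x, e x j && connect e j x].

Lemma oncycleP e j :
  reflect (exists2 x, e x j & connect e j x) (oncycle e j).
Proof. by apply: (iffP existsP) => [[x /andP[]]|[x ? ?]]; exists x => //; apply/andP. Qed.

(** Among the vertices reachable from [v], take one with the fewest descendants: an out-neighbour
    would have the same descendants, hence reach it back and close a cycle. *)
Lemma reach_noout e v :
  (forall c, cycle e c -> c = [::]) ->
  exists2 t, connect e v t & [forall u, ~~ e t u].
Proof.
move=> e_acyclic.
case: (arg_minnP (fun t => #|connect e t|) (connect0 e v)) => t vt tmin.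
exists t => //; apply/forallP=> u; apply/negP=> tu.
have ut : connect e u t.
  have /tmin le_tu : connect e v u := connect_trans vt (connect1 tu).
  have sub_ut : connect e u \subset connect e t.
    by apply/subsetP=> x; apply: connect_trans; apply: connect1.
  have /subset_cardP/(_ sub_ut) eq_ut : #|connect e u| = #|connect e t|.
    by apply/eqP; rewrite eqn_leq le_tu subset_leq_card.
  by have := eq_ut t; rewrite !inE => ->; apply: connect0.
case/connectP: ut => p up def_t.
suff: cycle e (u :: p) by move/e_acyclic.
by rewrite /= rcons_path up -def_t.
Qed.

End Connect.

Lemma path_linked (T : eqType) (R : rel T) a s :
  reflexive R -> transitive R -> path R a s ->
  {in a :: s &, forall x y, R x y || R y x} /\
  {in a :: s, forall x, R a x && R x (last a s)}.
Proof.
move=> Rxx R_trans; elim: s a => [|b s IHs] a /=.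
  by move=> _; split=> [x y|x] /[!inE]; [move=> /eqP-> /eqP->|move=> /eqP->]; rewrite Rxx.
case/andP=> ab bs; have [IHl IHm] := IHs b bs.
have aR x : x \in b :: s -> R a x by move/IHm/andP=> [/(R_trans _ _ _ ab)].
split.
  move=> x y; rewrite in_cons => /predU1P[->|xs]; rewrite in_cons => /predU1P[->|ys].
  - by rewrite Rxx.
  - by rewrite aR.
  - by rewrite aR ?orbT.
  - exact: IHl.
move=> x; rewrite in_cons => /predU1P[->|xs]; first by rewrite Rxx aR // mem_last.
by rewrite aR //; case/andP: (IHm x xs).
Qed.

Lemma mem_zip (S T : eqType) (s : seq S) (t : seq T) x y :
  (x, y) \in zip s t -> (x \in s) && (y \in t).
Proof.
elim: s t => [|a s IHs] [|b t] //=; rewrite !in_cons => /predU1P[[-> ->]|].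
  by rewrite !eqxx.
by case/IHs/andP=> -> ->; rewrite !orbT.
Qed.

Definition chain_tail (T : eqType) (c : seq T) v :=
  if c is a :: c' then v == last a c' else false.
Definition chain_head (T : eqType) (c : seq T) v :=
  if c is a :: _ then v == a else false.

(** * Surgery on the added edges *)

Section Digraphs.
Variable V : finType.
Implicit Types (E N M : {set V * V}) (A D I U C : {set V}) (i j v w x y : V).

Definition no_in E v := [forall u, ~~ adj E u v].
Definition no_out E v := [forall u, ~~ adj E v u].
Definition isolated E v := no_in E v && no_out E v.

Lemma no_outE E v u : no_out E v -> ((v, u) \in E) = false.
Proof. by move/forallP/(_ u)/negbTE. Qed.

Lemma no_inE E v u : no_in E v -> ((u, v) \in E) = false.
Proof. by move/forallP/(_ u)/negbTE. Qed.

Lemma reach_sink E v : acyclic E ->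
  exists2 t, connect (adj E) v t & no_out E t.
Proof. exact: reach_noout. Qed.

Lemma reach_source E v : acyclic E ->
  exists2 s, connect (adj E) s v & no_in E s.
Proof.
move=> E_acyclic; have [|s vs sP] := @reach_noout V (fun x y => adj E y x) v.
  move=> c; rewrite -rev_cycle => /E_acyclic/(congr1 rev).
  by rewrite revK.
by exists s => //; rewrite connect_rev.
Qed.

(** Identify [i] with its neighbour [p]. As [i] is isolated in [E], only edges of [N] move, and the
    edge [e0] joining the two collapses and is dropped. The set [D] records where the edges may end,
    so that contracted vertices stay untouched afterwards. *)
Lemma contract E N D i p : isolated E i -> N \subset setX D D -> p != i ->
    ((p, i) \in N) || ((i, p) \in N) ->
  exists M, [/\ M \subset setX (D :\ i) (D :\ i), #|M| < #|N|,
    forall x y, x != i -> y != i ->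
      connect (adj (E :|: N)) x y -> connect (adj (E :|: M)) x y
  & forall j, j != i ->
      oncycle (adj (E :|: N)) j -> oncycle (adj (E :|: M)) j].
Proof.
case/andP=> i_in i_out /subsetP ND pi Npi.
have [e0 Ne0 def_e0] : exists2 e, e \in N & (e == (p, i)) || (e == (i, p)).
  by case/orP: Npi => ?; [exists (p, i) | exists (i, p)]; rewrite ?eqxx ?orbT.
pose f x := if x == i then p else x.
have fp : f p = p by rewrite /f (negbTE pi).
have fi : f i = p by rewrite /f eqxx.
have fE x : x != i -> f x = x by rewrite /f => /negbTE ->.
pose M := [set (f e.1, f e.2) | e in N :\ e0].
have pD : p \in D by case/orP: Npi => /ND; rewrite inE /= => /andP[].
have fD x : x \in D -> f x \in D :\ i.
  by rewrite /f !inE; case: (eqVneq x i) => [_ _|-> ->] //; rewrite pi pD.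
have edge x y : adj (E :|: N) x y -> (x, y) != e0 -> adj (E :|: M) (f x) (f y).
  rewrite /adj !inE => /orP[Exy _|Nxy xye0].
    rewrite !fE ?Exy //; apply/eqP=> def_i; move: Exy; rewrite def_i.
      by rewrite (no_inE _ i_in).
    by rewrite (no_outE _ i_out).
  by apply/orP; right; apply/imsetP; exists (x, y) => //; rewrite !inE xye0.
have fe0 : f e0.1 = f e0.2 by case/orP: def_e0 => /eqP-> /=; rewrite fi fp.
have reach x y : connect (adj (E :|: N)) x y -> connect (adj (E :|: M)) (f x) (f y).
  apply: (@connect_homo _ _ _ _ f) => {}x {}y xy; have [def_xy | ne_xy] := eqVneq (x, y) e0.
    by move: fe0; rewrite -def_xy /= => ->.
  exact/connect1/edge.
exists M; split.
- apply/subsetP=> e /imsetP[[x y] /setD1P[_ /ND]]; rewrite inE /= => /andP[xD yD] ->.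
  by rewrite inE /= !fD.
- by rewrite (cardsD1 e0 N) Ne0 add1n ltnS leq_imset_card.
- by move=> x y xi yi /reach; rewrite !fE.
move=> j ji /oncycleP[x xj jx]; apply/oncycleP.
have [def_e0' | ne_e0] := eqVneq (x, j) e0; last first.
  by exists (f x); [rewrite -[j]fE //; apply: edge | rewrite -[j]fE //; apply: reach].
(* The edge entering [j] is the dropped one, which forces [j = p]. The walk from [p] to [i] ends
   with another edge [(z, i)], and this edge becomes one entering [p]. *)
have [def_x def_j] : x = i /\ j = p.
  move: def_e0; rewrite -def_e0' => /orP[]/eqP[]; last by [].
  by move=> _ def_j; rewrite def_j eqxx in ji.
subst x j.
have [z zi pz] := connect_last jx pi.
exists (f z); last by rewrite -{1}fp; apply: reach.
rewrite -[p in adj _ _ p]fi; apply: edge => //; rewrite -def_e0'.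
by apply/eqP=> -[_ /eqP]; rewrite eq_sym (negbTE pi).
Qed.

Definition linked (e : rel V) x y := connect e x y || connect e y x.

Lemma linked_incident E N i j : isolated E i -> linked (adj (E :|: N)) i j -> j != i ->
  exists2 p, p != i & ((p, i) \in N) || ((i, p) \in N).
Proof.
case/andP=> i_in i_out /orP ij ji.
(* Leaving out the loops preserves reachability and ensures that the first or last edge of a path at
   [i] has its other end elsewhere. *)
pose e : rel V := fun x y => adj (E :|: N) x y && (x != y).
have eP : connect (adj (E :|: N)) =2 connect e.
  move=> x y; apply/idP/idP; apply: (@connect_homo _ _ _ _ id) => {}x {}y xy.
    have [->//|ne_xy] := eqVneq x y.
    by apply/connect1/andP.
  by apply/connect1; case/andP: xy.
case: ij; rewrite eP.
  move/connect_first; rewrite eq_sym => /(_ ji)[p /andP[ip ne_ip] _].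
  exists p; first by rewrite eq_sym.
  by move: ip; rewrite /adj inE no_outE //= => ->; rewrite orbT.
case/connect_last/(_ ji) => p /andP[pi ne_pi] _; exists p => //.
by move: pi; rewrite /adj inE no_inE //= => ->.
Qed.

(** The vertices of [A] are contracted one at a time. Their link to [j], which survives each
    contraction, guarantees that there is always an edge left to contract along. *)
Lemma contract_set E N D A j : N \subset setX D D -> j \notin A ->
    (forall i, i \in A -> isolated E i && linked (adj (E :|: N)) i j) ->
  exists M, [/\ M \subset setX (D :\: A) (D :\: A), #|M| + #|A| <= #|N|,
    forall x y, x \notin A -> y \notin A ->
      connect (adj (E :|: N)) x y -> connect (adj (E :|: M)) x y
  & oncycle (adj (E :|: N)) j -> oncycle (adj (E :|: M)) j].
Proof.
elim: {A}_.+1 {-2}A (ltnSn #|A|) N D => // n IHn A le_A N D ND jA AP.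
have [->|[i Ai]] := set_0Vmem A.
  by exists N; split=> //; rewrite ?setD0 ?cards0 ?addn0.
have ji : j != i by apply: contraNneq jA => ->.
case/andP: (AP i Ai) => i_iso ij.
have [p pi Npi] := linked_incident i_iso ij ji.
have [M [MD le_M M_reach M_cyc]] := contract i_iso ND pi Npi.
have cardA : #|A| = (#|A :\ i|).+1 by rewrite (cardsD1 i) Ai.
have := IHn (A :\ i) _ M (D :\ i) MD.
case=> [| |k /setD1P[ki /AP/andP[k_iso kj]]|M' [M'D le_M' M'_reach M'_cyc]].
- by rewrite -ltnS -cardA.
- by rewrite !inE negb_and jA orbT.
- by rewrite k_iso /linked; case/orP: kj => /M_reach -> //; rewrite orbT.
exists M'; split.
- by have -> : D :\: A = D :\ i :\: (A :\ i) by rewrite setDDl setD1K.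
- by rewrite cardA addnS; apply: leq_ltn_trans le_M' le_M.
- move=> x y xA yA xy; apply: M'_reach; rewrite ?inE ?negb_and ?xA ?yA ?orbT //.
  by apply: M_reach => //; [apply: contraNneq xA => ->|apply: contraNneq yA => ->].
- by move=> /(M_cyc j ji)/M'_cyc.
Qed.

Lemma connect_isolated E x y : connect (adj E) x y -> isolated E x || isolated E y -> x = y.
Proof.
move=> xy isoxy; apply: contraTeq isoxy => ne_xy; rewrite negb_or; apply/andP; split.
  have [z xz _] := connect_first xy ne_xy.
  by apply/negP=> /andP[_ /forallP/(_ z)]; rewrite xz.
have [z zy _] := connect_last xy ne_xy.
by apply/negP=> /andP[/forallP/(_ z)]; rewrite zy.
Qed.

Lemma connect_setU E N x y : connect (adj E) x y -> connect (adj (E :|: N)) x y.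
Proof. by apply: (@connect_homo _ _ _ _ id) => {}x {}y xy; apply/connect1; rewrite /adj inE [_ \in E]xy. Qed.

(* An edge (v, u) becomes an edge from a sink reachable from v to a source
   reaching u; such a vertex is isolated only if it is v or u itself. *)
Lemma normalize E M D : acyclic E -> M \subset setX D D ->
  exists M', [/\ #|M'| <= #|M|,
    forall x y, connect (adj (E :|: M)) x y -> connect (adj (E :|: M')) x y,
    forall j, isolated E j ->
      oncycle (adj (E :|: M)) j -> oncycle (adj (E :|: M')) j
  & forall e, e \in M' -> [/\ no_out E e.1, no_in E e.2,
      isolated E e.1 -> e.1 \in D & isolated E e.2 -> e.2 \in D]].
Proof.
move=> E_acyclic /subsetP MD.
have /fin_all_exists[t tP] v : exists t, connect (adj E) v t && no_out E t.
  by have [t vt t_out] := reach_sink v E_acyclic; exists t; apply/andP.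
have /fin_all_exists[s sP] v : exists s, connect (adj E) s v && no_in E s.
  by have [s sv s_in] := reach_source v E_acyclic; exists s; apply/andP.
pose M' := [set (t e.1, s e.2) | e in M].
have reach x y : connect (adj (E :|: M)) x y -> connect (adj (E :|: M')) x y.
  apply: (@connect_homo _ _ _ _ id) => {}x {}y; rewrite {1}/adj inE => /orP[xy|Mxy].
    exact/connect_setU/connect1.
  have [/andP[xt _] /andP[sy _]] := (tP x, sP y).
  apply: connect_trans (connect_setU _ xt) (connect_trans _ (connect_setU _ sy)).
  by apply/connect1; rewrite /adj inE; apply/orP; right; apply/imsetP; exists (x, y).
exists M'; split=> //; first exact: leq_imset_card.
(* An edge entering the isolated vertex [j] comes from [M], and [s j = j], so its replacement still
   enters [j]. *)
- move=> j j_iso /oncycleP[x xj jx]; apply/oncycleP; exists (t x); last first.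
    by apply: connect_trans (reach _ _ jx) (connect_setU _ _); case/andP: (tP x).
  move: xj; rewrite /adj !inE; case/andP: (j_iso) => j_in _; rewrite no_inE //= => Mxj.
  apply/orP; right; apply/imsetP; exists (x, j) => //=.
  by have /andP[/connect_isolated->] := sP j; rewrite ?j_iso ?orbT.
- move=> e /imsetP[[x y] /MD]; rewrite inE /= => /andP[xD yD] -> /=.
  have [/andP[xt ->] /andP[sy ->]] := (tP x, sP y); split=> // iso_v.
    by rewrite -(connect_isolated xt) // iso_v orbT.
  by rewrite (connect_isolated sy) // iso_v.
Qed.

Definition path_edges (c : seq V) : {set V * V} := [set p | p \in zip c (behead c)].

(* Substitutes the path [a :: c] for the vertex [j] of [M]. *)
Definition inflate a c j M : {set V * V} :=
  path_edges (a :: c) :|: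
  [set (if e.1 == j then last a c else e.1, if e.2 == j then a else e.2) | e in M].

Section Inflate.
Variables (E M : {set V * V}) (a : V) (c : seq V) (j : V).
Hypothesis j_iso : isolated E j.
Let N := inflate a c j M.
Let r := connect (adj (E :|: N)).

Lemma card_inflate : #|N| <= #|M| + size c.
Proof.
apply: leq_trans (leq_card_setU _ _) _; rewrite addnC leq_add ?leq_imset_card //.
rewrite cardsE; apply: leq_trans (card_size _) _.
by rewrite size_zip geq_minr.
Qed.

Lemma inflate_path : path r a c.
Proof.
have zipP s x : {subset zip (x :: s) s <= N} -> path r x s.
  elim: s x => //= b s IHs x xsN; rewrite IHs => [|e es].
    by rewrite andbT; apply/connect1; rewrite /adj inE xsN ?orbT // mem_head.
  by apply: xsN; rewrite in_cons es orbT.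
by apply: zipP => e e_zip; rewrite !inE e_zip.
Qed.

Lemma inflate_linked : {in a :: c &, forall x y, r x y || r y x}.
Proof. by case: (path_linked (@connect0 _ _) (@connect_trans _ _) inflate_path). Qed.

Lemma inflate_ends : {in a :: c, forall x, r a x && r x (last a c)}.
Proof. by case: (path_linked (@connect0 _ _) (@connect_trans _ _) inflate_path). Qed.

(** Images of [x] as a head and as a tail of edges: the path is entered at its first vertex and left
    at its last one, and [f x] always reaches [g x]. *)
Let f x := if x == j then a else x.
Let g x := if x == j then last a c else x.

Let fg x : r (f x) (g x).
Proof.
rewrite /f /g; case: eqP => _; last exact: connect0.
by case/andP: (inflate_ends (mem_last a c)).
Qed.

Let edge x y : adj (E :|: M) x y -> adj (E :|: N) (g x) (f y).
Proof.
rewrite /adj !inE => /orP[Exy|Mxy]; last first.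
  by apply/orP; right; apply/orP; right; apply/imsetP; exists (x, y).
case/andP: j_iso => j_in j_out; rewrite /g /f.
have [def_x|_] := eqVneq x j; first by rewrite def_x no_outE in Exy.
have [def_y|_] := eqVneq y j; first by rewrite def_y no_inE in Exy.
by rewrite Exy.
Qed.

Lemma inflate_connect x y : connect (adj (E :|: M)) x y -> r (f x) (f y).
Proof.
by apply: connect_homo => {}x {}y /edge xy; apply: connect_trans (fg x) (connect1 xy).
Qed.

Lemma inflate_connect_ne x y : connect (adj (E :|: M)) x y -> x != y -> r (g x) (f y).
Proof.
move=> xy /(connect_first xy)[z /edge xz /inflate_connect zy].
exact: connect_trans (connect1 xz) zy.
Qed.

(** A closed walk through [j] turns into a walk that leaves the path at its end and returns to its
    start, so that all vertices of the path become mutually reachable. *)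
Lemma inflate_oncycle : oncycle (adj (E :|: M)) j -> r (last a c) a.
Proof.
case/oncycleP=> x /edge; rewrite /f eqxx => xj jx.
have [def_x | ne_jx] := eqVneq j x.
  by apply/connect1; move: xj; rewrite -def_x /g eqxx.
have := inflate_connect_ne jx ne_jx; rewrite {1}/g eqxx => jfx.
exact: connect_trans jfx (connect_trans (fg x) (connect1 xj)).
Qed.

End Inflate.

(** * Counting connected pairs *)

Lemma connectivityE E :
  connectivity E = \sum_x \sum_y (connect (adj E) x y : nat).
Proof.
rewrite /connectivity -sum1dep_card big_mkcond pair_bigA.
by apply: eq_bigr => p _; case: connect.
Qed.

Lemma leq_connectivity E N N' :
  (forall x y, connect (adj (E :|: N)) x y -> connect (adj (E :|: N')) x y) ->
  connectivity (E :|: N) <= connectivity (E :|: N').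
Proof. by move=> sub; apply/subset_leq_card/subsetP=> p /[!inE]; apply: sub. Qed.

Definition outer_degree (R : rel V) I i := \sum_(w | w \notin I) (R i w + R w i).
(** The pair [(i, i)] counts twice here, so that summing over [U] gives exactly twice the number of
    pairs inside [U]. *)
Definition inner_degree (R : rel V) U i := \sum_(k in U) (R i k + R k i).

Lemma sum_pairs_split (R : rel V) I :
  \sum_x \sum_y (R x y : nat) =
    \sum_(x | x \notin I) \sum_(y | y \notin I) (R x y : nat) +
    \sum_(i in I) outer_degree R I i + \sum_(i in I) \sum_(k in I) (R i k : nat).
Proof.
rewrite (bigID (mem I)) /=.
under eq_bigr => x _ do rewrite (bigID (mem I)) /=.
under [X in _ + X = _]eq_bigr => x _ do rewrite (bigID (mem I)) /=.
rewrite !big_split /= [X in _ + (X + _) = _]exchange_big /=.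
rewrite /outer_degree; under [X in _ = _ + X + _]eq_bigr do rewrite big_split.
rewrite big_split /=; lia.
Qed.

Lemma sum_inner_degree (R : rel V) U :
  \sum_(i in U) inner_degree R U i = (\sum_(i in U) \sum_(k in U) (R i k : nat)).*2.
Proof.
rewrite /inner_degree; under eq_bigr do rewrite big_split.
by rewrite big_split /= [X in _ + X]exchange_big addnn.
Qed.

Lemma sum_eq1 U i : i \in U -> \sum_(k in U) (k == i : nat) = 1.
Proof.
move=> Ui; rewrite (bigD1 i) //= eqxx big1 // => k /andP[_ /negbTE->] //.
Qed.

(* The vertices of [U] are traded for those of the chain [C], each of which does
   as well as the best element [j] of [U].  Pairs inside [U] are counted twice,
   once for each member: [j] is in at most [#|U| + 1] of them unless it lies on
   a cycle, while each member of a chain is in at least [#|C| + 1]. *)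
Lemma leq_sum_pairs_chain (R R' : rel V) I U C j (cy : bool) :
  U \subset I -> C \subset I -> #|U| = #|C| -> reflexive R -> reflexive R' ->
  (forall i x, i \in I -> i \notin U -> x != i -> ~~ R i x && ~~ R x i) ->
  (forall x y, x \notin I -> y \notin I -> R x y -> R' x y) -> j \in U ->
  (forall c w, c \in C -> w \notin I -> (R j w -> R' c w) /\ (R w j -> R' w c)) ->
  {in C &, forall c d, R' c d || R' d c} ->
  (cy -> {in C &, forall c d, R' c d}) ->
  (~~ cy -> forall k, k \in U -> k != j -> ~~ (R j k && R k j)) ->
  (forall i, i \in U -> (outer_degree R I i).*2 + inner_degree R U i
                     <= (outer_degree R I j).*2 + inner_degree R U j) ->
  \sum_x \sum_y (R x y : nat) <= \sum_x \sum_y (R' x y : nat).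
Proof.
move=> UI CI cardUC Rxx R'xx unused RR' Uj jC linkedC cyC cyU jmax.
(* A vertex of [I :\: U] is related to itself only. *)
have def_R : \sum_x \sum_y (R x y : nat) =
    \sum_(x | x \notin I) \sum_(y | y \notin I) (R x y : nat) +
    \sum_(i in U) outer_degree R I i + \sum_(i in U) \sum_(k in U) (R i k : nat) + #|I :\: U|.
  rewrite (sum_pairs_split _ I) (big_setID U) /= (setIidPr UI).
  rewrite [X in _ + X + _ = _](_ : _ = \sum_(i in U) outer_degree R I i); last first.
    rewrite [X in _ + X]big1 ?addn0 // => i /setDP[Ii U'i].
    rewrite /outer_degree big1 // => w Iw.
    have wi : w != i by apply: contraNneq Iw => ->.
    by have /andP[/negbTE-> /negbTE->] := unused i w Ii U'i wi.
  rewrite -!addnA; congr (_ + (_ + _)).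
  rewrite (big_setID U) /= (setIidPr UI) -sum1_card; congr (_ + _).
    apply: eq_bigr => i Ui; rewrite (big_setID U) /= (setIidPr UI).
    rewrite [X in _ + X]big1 ?addn0 // => k /setDP[Ik U'k].
    have ik : i != k by apply: contraNneq U'k => <-.
    by have /andP[_ /negbTE->] := unused k i Ik U'k ik.
  apply: eq_bigr => i /setDP[Ii U'i]; rewrite (bigD1 i) //= Rxx big1 // => k /andP[_ ki].
  by have /andP[/negbTE-> _] := unused i k Ii U'i ki.
(* Each vertex of [C] has at least the outer degree of [j]; a vertex of [I :\: C] is credited only
   with the pair it forms with itself. *)
have le_R' : \sum_(x | x \notin I) \sum_(y | y \notin I) (R x y : nat) +
    #|C| * outer_degree R I j + \sum_(i in C) \sum_(k in C) (R' i k : nat) + #|I :\: C|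
    <= \sum_x \sum_y (R' x y : nat).
  rewrite [leqRHS](sum_pairs_split _ I) -!addnA; apply: leq_add.
    apply: leq_sum => x Ix; apply: leq_sum => y Iy.
    by case Rxy: (R x y); rewrite // RR'.
  apply: leq_add.
    rewrite (big_setID C) /= (setIidPr CI) -sum_nat_const; apply: leq_trans (leq_addr _ _).
    apply: leq_sum => c Cc; apply: leq_sum => w Iw; have [jw wj] := jC c w Cc Iw.
    by apply: leq_add; [case: (R j w) jw | case: (R w j) wj] => // ->.
  rewrite [leqRHS](big_setID C) /= (setIidPr CI) -sum1_card; apply: leq_add.
    apply: leq_sum => c Cc; rewrite [leqRHS](big_setID C) /= (setIidPr CI); exact: leq_addr.
  apply: leq_sum => i /setDP[Ii _]; rewrite (bigD1 i) //= R'xx; exact: leq_addr.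
have cardID : #|I :\: U| = #|I :\: C|.
  by rewrite !cardsD (setIidPr UI) (setIidPr CI) cardUC.
have ge_R' c : c \in C -> inner_degree R U j <= inner_degree R' C c.
  move=> Cc; case Ecy: cy.
    apply: (@leq_trans (\sum_(k in C) 2)).
      rewrite sum_nat_const -cardUC -sum_nat_const; apply: leq_sum => k _.
      by case: (R _ _); case: (R _ _).
    by apply: leq_sum => k Ck; rewrite !cyC.
  apply: (@leq_trans (\sum_(k in U) (1 + (k == j)))).
    apply: leq_sum => k Uk; case: eqVneq => [_|kj].
      by case: (R _ _); case: (R _ _).
    have := cyU (negbT Ecy) k Uk kj.
    by case: (R _ _); case: (R _ _).
  apply: (@leq_trans (\sum_(k in C) (1 + (k == c)))).
    by rewrite !big_split /= !sum_eq1 // !sum1_card cardUC.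
  apply: leq_sum => k Ck; case: eqVneq => [->|_]; first by rewrite R'xx.
  by have := linkedC c k Cc Ck; case: (R' _ _); case: (R' _ _).
(* Summed over [U], the score maximized by [j] is twice the number of pairs to be compared, so the
   final comparison is made after doubling. *)
have leU : (\sum_(i in U) outer_degree R I i).*2 + \sum_(i in U) inner_degree R U i
    <= #|C| * ((outer_degree R I j).*2 + inner_degree R U j).
  rewrite -addnn -!big_split /= -cardUC -sum_nat_const; apply: leq_sum => i Ui.
  by rewrite addnn jmax.
have leC : #|C| * inner_degree R U j <= \sum_(c in C) inner_degree R' C c.
  by rewrite -sum_nat_const; apply: leq_sum => c /ge_R'.
rewrite !sum_inner_degree in leU leC.
rewrite mulnDr -doubleMr in leU.
rewrite def_R cardID; apply: leq_trans le_R'.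
rewrite leq_add2r -!addnA leq_add2l -leq_double !doubleD.
by apply: leq_trans leU _; rewrite leq_add2l.
Qed.

Definition degree (R : rel V) v := \sum_x (R v x + R x v).

(* Contracting [i] saves an edge, which is used to insert [i] just after [j];
   the strict gain is the new pair [(j, i)]. *)
Lemma exchange E B N i j p :
  feasible E B N -> isolated E i -> isolated E j ->
  p != i -> ((p, i) \in N) || ((i, p) \in N) ->
  ~~ linked (adj (E :|: N)) i j ->
  degree (connect (adj (E :|: N))) i <= degree (connect (adj (E :|: N))) j ->
  exists2 N', feasible E B N' & connectivity (E :|: N) < connectivity (E :|: N').
Proof.
move=> [_ leB] i_iso j_iso pi Npi nij le_ij.
have ne_ij : i != j by apply: contraNneq nij => ->; rewrite /linked connect0.
have NT : N \subset setX [set: V] [set: V] by apply/subsetP=> e _; rewrite !inE.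
have [M [_ ltM reachM _]] := contract i_iso NT pi Npi.
(* The first vertex of the inserted path is [j] itself: edges entering [j] stay in place and those
   leaving it now leave from [i]. *)
pose N' := inflate j [:: i] j M.
(* Contraction may have produced edges of [E], which a feasible set must avoid; removing them leaves
   the union unchanged. *)
have def_N' : E :|: N' :\: E = E :|: N' by apply/setP=> e; rewrite !inE; case: (e \in E).
exists (N' :\: E).
  split; first by rewrite setDE subsetIr.
  apply: leq_trans (subset_leq_card (subsetDl _ _)) _.
  apply: leq_trans (card_inflate _ _ _ _) _; rewrite addn1.
  exact: leq_trans ltM leB.
rewrite def_N'.
set R := connect (adj (E :|: N)) in nij reachM le_ij *.
set R' := connect (adj (E :|: N')).
have i_neq w : w \notin [set i] -> w != i by rewrite inE.
have RR' x y : x != i -> y != i -> R x y -> R' x y.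
  move=> xi yi /(reachM _ _ xi yi)/(inflate_connect j [:: i] j_iso) /=.
  by case: (eqVneq x j) => [->|_]; case: (eqVneq y j) => [->|_].
have jR' y : y != i -> y != j -> R j y -> R' i y.
  move=> yi yj /reachM-/(_ _ yi); rewrite eq_sym => /(_ ne_ij).
  move/(inflate_connect_ne j [:: i] j_iso); rewrite eq_sym => /(_ yj) /=.
  by rewrite eqxx (negbTE yj).
have R'ji : R' j i.
  by have /(_ j (mem_head _ _))/andP[] := @inflate_ends E M j [:: i] j.
rewrite !connectivityE -/R -/R' 2!(sum_pairs_split _ [set i]) !big_set1.
have le_rest : \sum_(x | x \notin [set i]) \sum_(y | y \notin [set i]) (R x y : nat)
   <= \sum_(x | x \notin [set i]) \sum_(y | y \notin [set i]) (R' x y : nat).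
  apply: leq_sum => x /i_neq xi; apply: leq_sum => y /i_neq yi.
  by case Rxy: (R x y); rewrite // RR'.
have [nRij nRji] : R i j = false /\ R j i = false.
  by move: nij; rewrite negb_or => /andP[/negbTE ? /negbTE ?]; split.
(* The pair [(i, i)] counts twice in [degree R i], whereas [j] loses nothing when [i] is set apart,
   the two being incomparable. *)
have deg_i : degree R i = (outer_degree R [set i] i).+2.
  rewrite /degree (bigID (mem [set i])) /= big_set1 /outer_degree.
  by rewrite /R connect0.
have deg_j : degree R j = outer_degree R [set i] j.
  rewrite /degree (bigID (mem [set i])) /= big_set1 /outer_degree.
  by rewrite nRij nRji.
(* At [w = j] the double count of [(j, j)] may be matched only by the new pair [(j, i)], hence the
   correction by one. The surplus of two in [deg_i] absorbs it and leaves a strict gain. *)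
have le_j : \sum_(w | w \notin [set i]) (R j w + R w j)
    <= \sum_(w | w \notin [set i]) (R' i w + R' w i + (w == j)).
  apply: leq_sum => w /i_neq wi; have [->|wj] := eqVneq w j.
    by rewrite R'ji [R j j]connect0; case: (R' i j).
  rewrite addn0 leq_add //; first by case Rjw: (R j w); rewrite // jR'.
  case Rwj: (R w j) => //; have ji : j != i by rewrite eq_sym.
  by rewrite [R' w i](connect_trans (RR' _ _ wi ji Rwj) R'ji).
have def_1 : \sum_(w | w \notin [set i]) (w == j : nat) = 1.
  have := @sum_eq1 (~: [set i]) j; rewrite !inE eq_sym ne_ij => /(_ isT) <-.
  by apply: eq_bigl => w; rewrite !inE.
rewrite [leqRHS]big_split /= def_1 in le_j.
rewrite [R i i]connect0 [R' i i]connect0.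
rewrite deg_i deg_j in le_ij.
rewrite ltn_add2r -addnS; apply: leq_add le_rest _.
by rewrite addn1 in le_j; rewrite -ltnS; apply: leq_trans le_ij le_j.
Qed.

End Digraphs.

(** * The shape of optimal solutions *)

Section Optimum.
Variable V : finType.
Implicit Types (E N M : {set V * V}) (A D I U C : {set V}) (i j v w x y : V).

Definition chain_cand E c (e : V * V) :=
  [&& no_out E e.1, no_in E e.2, isolated E e.1 ==> chain_tail c e.1
    & isolated E e.2 ==> chain_head c e.2].

Lemma feasible_no_out E B N :
  (forall e, e \in N -> no_out E e.1) -> #|N| <= B -> feasible E B N.
Proof.
move=> N_out leB; split=> //; apply/subsetP=> -[x y] /N_out x_out.
by rewrite inE no_outE.
Qed.

(* Loops are excluded so that an isolated vertex touched by [N] is linked to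
   another vertex. *)
Lemma loopless_optimal E B : exists2 N, mci_optimal E B N &
  forall e, e \in N -> e.1 != e.2.
Proof.
pose feas N := (N \subset ~: E) && (#|N| <= B).
have feas0 : feas set0 by rewrite /feas sub0set cards0.
case: (arg_maxnP (fun N => connectivity (E :|: N)) feas0) => N /andP[NE leB] Nmax.
exists [set e in N | e.1 != e.2]; last by move=> e; rewrite inE => /andP[].
have subN : [set e in N | e.1 != e.2] \subset N by apply/subsetP=> e; rewrite inE => /andP[].
split; first by split; [apply: subset_trans subN NE | apply: leq_trans (subset_leq_card subN) leB].
move=> N' [N'E leN'B]; apply: leq_trans (Nmax N' _) _; first by rewrite /= /feas N'E.
apply: leq_connectivity; apply: (@connect_homo _ _ _ _ id) => x y.
rewrite /adj inE; have [-> //|ne_xy] := eqVneq x y => xy.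
by apply/connect1; rewrite /adj !inE /= ne_xy andbT.
Qed.

(** The length [r] is chosen before the chain [c]: it is the number of isolated vertices used by
    some optimal solution, and any [r] of them serve equally well. The search can thus restrict
    itself to one chain of each length. *)
Lemma chain_optimal E B : acyclic E ->
  exists2 r, r <= #|[set v | isolated E v]| &
    forall c, uniq c -> all (isolated E) c -> size c = r ->
      exists N, [/\ mci_optimal E B N, path_edges c \subset N
        & forall e, e \in N -> (e \in path_edges c) || chain_cand E c e].
Proof.
move=> E_acyclic; have [N [[NE leB] Nmax] N_loopless] := loopless_optimal E B.
pose I := [set v | isolated E v]; pose R := connect (adj (E :|: N)).
pose U := [set i in I | [exists x, (x != i) && linked (adj (E :|: N)) i x]].
have UI : U \subset I by apply/subsetP=> i; rewrite inE => /andP[].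
have isoU i : i \in U -> isolated E i by move/(subsetP UI); rewrite inE.
pose D := ~: (I :\: U).
have ND : N \subset setX D D.
  apply/subsetP=> -[x y] Nxy; have /= ne_xy := N_loopless _ Nxy.
  have xy : R x y by apply/connect1; rewrite /adj inE Nxy orbT.
  have xU : isolated E x -> x \in U.
    move=> x_iso; rewrite !inE x_iso; apply/existsP; exists y.
    by rewrite eq_sym ne_xy /linked [connect _ _ _]xy.
  have yU : isolated E y -> y \in U.
    move=> y_iso; rewrite !inE y_iso; apply/existsP; exists x.
    by rewrite ne_xy /linked [connect _ x y]xy orbT.
  apply/setXP; split; rewrite in_setC in_setD negb_and negbK orbC -implybE [_ \in I]inE;
    exact/implyP.
have linkedU : {in U &, forall i k, linked (adj (E :|: N)) i k}.
  have linkedC i k : linked (adj (E :|: N)) i k = linked (adj (E :|: N)) k i by apply: orbC.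
  move=> i k Ui Uk; apply/idPn; wlog le_ik : i k Ui Uk / degree R i <= degree R k.
    by move=> IH nik; case: (leqP (degree R i) (degree R k)) => [|/ltnW] /IH; [|rewrite linkedC]; apply.
  move=> nik; case/setIdP: (Ui) => _ /existsP[x /andP[xi ix]].
  have [p pi Npi] := linked_incident (isoU i Ui) ix xi.
  have [N' N'feas] := exchange (conj NE leB) (isoU i Ui) (isoU k Uk) pi Npi nik le_ik.
  by rewrite ltnNge Nmax.
have [U0 | [j0 Uj0]] := set_0Vmem U.
  exists 0 => // c _ _ /size0nil ->.
  have [M' [leM' reachM' _ M'P]] := normalize E_acyclic ND.
  have isoM' v : (isolated E v -> v \in D) -> ~~ isolated E v.
    by move=> vD; apply/negP=> v_iso; move: (vD v_iso); rewrite /D U0 setD0 !inE v_iso.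
  exists M'; split.
  - split; last by move=> N' /Nmax/leq_trans; apply; apply: leq_connectivity.
    by apply: feasible_no_out => [e /M'P[]//|]; apply: leq_trans leM' leB.
  - by apply/subsetP=> e; rewrite inE.
  - move=> e /M'P[e1 e2 /isoM'/negbTE iso1 /isoM'/negbTE iso2].
    by rewrite /chain_cand e1 e2 iso1 iso2 orbT.
case: (arg_maxnP (fun i => (outer_degree R I i).*2 + inner_degree R U i) Uj0) => j Uj' jmax.
have {Uj'} Uj : j \in U := Uj'.
have j_iso := isoU j Uj.
exists #|U| => [|c Uc c_iso size_c]; first exact: subset_leq_card.
have [||M [MD leM reachM cycM]] := @contract_set V E N D (U :\ j) j ND.
- by rewrite !inE eqxx.
- by move=> i /setD1P[_ Ui]; rewrite isoU // linkedU.
have [M' [leM' reachM' cycM' M'P]] := normalize E_acyclic MD.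
case: c => [|a c] in Uc c_iso size_c *; first by rewrite (cardsD1 j) Uj in size_c.
pose N' := inflate a c j M'; exists N'.
have isoc v : v \in a :: c -> isolated E v by move/(allP c_iso).
(* The isolated vertices in [D] are those of [U], and all of them but [j] have been contracted. *)
have isoM' v : (isolated E v -> v \in D :\: (U :\ j)) -> isolated E v -> v = j.
  move=> vD v_iso; have [//|ne_vj] := eqVneq v j; move: (vD v_iso).
  by rewrite !inE ne_vj v_iso; case: [exists _, _].
have N'P e : e \in N' -> (e \in path_edges (a :: c)) || chain_cand E (a :: c) e.
  case/setUP=> [->//|/imsetP[[x y] /M'P[/= x_out y_in xP yP] ->]].
  apply/orP; right; rewrite /chain_cand /=; apply/and4P; split.
  - by case: eqP => // _; case/andP: (isoc _ (mem_last a c)).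
  - by case: eqP => // _; case/andP: (isoc _ (mem_head a c)).
  - by apply/implyP; case: eqP => // ne_xj /(isoM' _ xP).
  - by apply/implyP; case: eqP => // ne_yj /(isoM' _ yP).
have N'_out e : e \in N' -> no_out E e.1.
  case/N'P/orP=> [|/and4P[]//]; rewrite inE; by case: e => x y /mem_zip/andP[/isoc/andP[]].
split=> //; last exact: subsetUl.
have cardU : #|U| = (#|U :\ j|).+1 by rewrite (cardsD1 j) Uj.
split.
  (* The path has [#|U :\ j|] edges, no more than the contraction saved. *)
  apply: feasible_no_out => //; apply: leq_trans leB; apply: leq_trans leM.
  apply: leq_trans (card_inflate _ _ _ _) _; rewrite leq_add //.
  by rewrite -ltnS -cardU -size_c.
move=> N'' /Nmax/leq_trans; apply; rewrite !connectivityE.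
have IA v : v \notin I -> v \notin U :\ j.
  by apply: contra => /setD1P[_ /(subsetP UI)].
have Ij v : v \notin I -> v == j = false.
  by move=> Iv; apply: contraNF Iv => /eqP->; rewrite inE.
have jA : j \notin U :\ j by rewrite !inE eqxx.
apply: (@leq_sum_pairs_chain V R _ I U [set x in a :: c] j (oncycle (adj (E :|: N)) j)) => //.
- by apply/subsetP=> v; rewrite !inE => /isoc.
- by rewrite [RHS]cardsE (card_uniqP Uc) -size_c.
- move=> x; exact: connect0.
- move=> i x Ii; rewrite inE Ii /= => /existsPn/(_ x) nUi xi.
  by move: nUi; rewrite xi negb_or.
- move=> x y Ix Iy xy.
  have := inflate_connect a c j_iso (reachM' _ _ (reachM _ _ (IA x Ix) (IA y Iy) xy)).
  by rewrite !Ij.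
- move=> d w; rewrite inE => /(inflate_ends E M' j)/andP[ad dl] Iw; split.
    move=> /(reachM _ _ jA (IA w Iw))/reachM'/(inflate_connect_ne a c j_iso).
    by rewrite eq_sym Ij // eqxx => /(_ isT); apply: connect_trans.
  move=> /(reachM _ _ (IA w Iw) jA)/reachM'/(inflate_connect a c j_iso).
  by rewrite Ij // eqxx => /connect_trans; apply.
- by move=> d d'; rewrite !inE; apply: inflate_linked.
- move=> /cycM/(cycM' _ j_iso)/(inflate_oncycle a c j_iso) la d d'; rewrite !inE.
  move=> /(inflate_ends E M' j)/andP[_ dl] /(inflate_ends E M' j)/andP[ad' _].
  exact: connect_trans dl (connect_trans la ad').
(* If [j] and [k] reach each other, the last edge of a path from [k] to [j] closes a walk through
   [j]. *)
move=> ncyc k Uk kj; apply: contra ncyc => /andP[jk kj'].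
have [x xj kx] := connect_last kj' kj.
by apply/oncycleP; exists x => //; apply: connect_trans kx.
Qed.

End Optimum.

(** * Bounded-loop programs *)

Inductive lprog :=
  | LSkip
  | LAssign of nat & expr
  | LStore of expr & expr
  | LSeq of lprog & lprog
  | LIf of expr & lprog & lprog
  | LFor of nat & nat & lprog.

Definition setr (s : state) (r v : nat) : state := State (upd (reg s) r v) (memory s).
Definition setm (s : state) (a v : nat) : state := State (reg s) (upd (memory s) a v).

(* [LFor i b p] runs [p] with register [i] equal to 0, 1, ... up to the value
   that register [b] has at the start, and leaves that value in [i]. *)
Fixpoint run (p : lprog) (s : state) : state :=
  match p with
  | LSkip => s
  | LAssign r e => setr s r (eval s e)
  | LStore a e => setm s (eval s a) (eval s e)
  | LSeq p q => run q (run p s)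
  | LIf e p q => if eval s e != 0 then run p s else run q s
  | LFor i b p =>
      setr (iteri (reg s b) (fun k st => run p (setr st i k)) s) i (reg s b)
  end.

Fixpoint compile (p : lprog) : cmd :=
  match p with
  | LSkip => Skip
  | LAssign r e => Assign r e
  | LStore a e => Store a e
  | LSeq p q => Seq (compile p) (compile q)
  | LIf e p q => If e (compile p) (compile q)
  | LFor i b p =>
      Seq (Assign i (Lit 0))
        (While (Sub (Reg b) (Reg i))
           (Seq (compile p) (Assign i (Add (Reg i) (Lit 1)))))
  end.

Fixpoint writes (p : lprog) : seq nat :=
  match p with
  | LSkip | LStore _ _ => [::]
  | LAssign r _ => [:: r]
  | LSeq p q | LIf _ p q => writes p ++ writes q
  | LFor i _ p => i :: writes p
  end.

Fixpoint bounds (p : lprog) : seq nat :=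
  match p with
  | LSkip | LStore _ _ | LAssign _ _ => [::]
  | LSeq p q | LIf _ p q => bounds p ++ bounds q
  | LFor _ b p => b :: bounds p
  end.

Fixpoint fresh_indices (p : lprog) : bool :=
  match p with
  | LSkip | LStore _ _ | LAssign _ _ => true
  | LSeq p q | LIf _ p q => fresh_indices p && fresh_indices q
  | LFor i _ p => (i \notin writes p) && fresh_indices p
  end.

(** No loop bound is written anywhere in the program, so all bounds keep their initial values and
    the running time can be computed from the initial registers. *)
Definition steady (p : lprog) : bool := all (fun b => b \notin writes p) (bounds p).

Definition well_formed p := fresh_indices p && steady p.

(** A loop pays 2 for initializing the index, 4 for the last, failing test and, in each iteration, 4
    for the test and 4 for the increment. A conditional is charged for both branches. *)
Fixpoint time (m : nat -> nat) (p : lprog) : nat :=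
  match p with
  | LSkip => 1
  | LAssign _ e => (cost e).+1
  | LStore a e => (cost a + cost e).+1
  | LSeq p q => time m p + time m q
  | LIf e p q => (cost e + (time m p + time m q)).+1
  | LFor _ b p => 6 + m b * (time m p + 8)
  end.

(** Coefficient of [M ^ depth p] in a bound on [time] when all loop bounds are at most [M]; the 14
    of a loop is 6 + 8. *)
Fixpoint weight (p : lprog) : nat :=
  match p with
  | LSkip => 1
  | LAssign _ e => (cost e).+1
  | LStore a e => (cost a + cost e).+1
  | LSeq p q => weight p + weight q
  | LIf e p q => (cost e + (weight p + weight q)).+1
  | LFor _ b p => weight p + 14
  end.

Fixpoint depth (p : lprog) : nat :=
  match p with
  | LSkip | LAssign _ _ | LStore _ _ => 0
  | LSeq p q | LIf _ p q => maxn (depth p) (depth q)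
  | LFor _ _ p => (depth p).+1
  end.

Lemma regE_writes p s r : r \notin writes p -> reg (run p s) r = reg s r.
Proof.
elim: p s => //= [r' e|p IHp q IHq|e p IHp q IHq|i b p IHp] s.
- by rewrite inE /upd => /negbTE->.
- by rewrite mem_cat negb_or => /andP[/IHp Ep /IHq->]; rewrite Ep.
- by rewrite mem_cat negb_or => /andP[/IHp Ep /IHq Eq]; case: ifP.
rewrite inE negb_or => /andP[/negbTE r_i /IHp Ep]; rewrite /upd r_i.
by elim: (reg s b) => //= k IHk; rewrite Ep /= /upd r_i.
Qed.

Lemma regE_all p s rs : all (fun r => r \notin writes p) rs ->
  forall r, r \in rs -> reg (run p s) r = reg s r.
Proof. by move=> /allP p_rs r /p_rs/regE_writes. Qed.

Lemma eq_in_time m m' p : {in bounds p, m =1 m'} -> time m p = time m' p.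
Proof.
elim: p => //= [p IHp q IHq|e p IHp q IHq|i b p IHp] mm'.
- by rewrite IHp ?IHq // => r rb; apply: mm'; rewrite mem_cat rb ?orbT.
- by rewrite IHp ?IHq // => r rb; apply: mm'; rewrite mem_cat rb ?orbT.
by rewrite mm' ?mem_head // IHp // => r rb; apply: mm'; rewrite in_cons rb orbT.
Qed.

Lemma exec_compile p s : well_formed p ->
  exists2 t, exec (compile p) s t (run p s) & t <= time (reg s) p.
Proof.
rewrite /well_formed /steady; elim: p s => /=.
- by move=> s _; exists 1 => //; constructor.
- by move=> r e s _; exists (cost e).+1 => //; constructor.
- by move=> a e s _; exists (cost a + cost e).+1 => //; constructor.
- move=> p IHp q IHq s /andP[/andP[wp wq] /allP st].
  have stp b : b \in bounds p -> b \notin writes p ++ writes q.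
    by move=> bp; apply: st; rewrite mem_cat bp.
  have stq b : b \in bounds q -> b \notin writes p ++ writes q.
    by move=> bq; apply: st; rewrite mem_cat bq orbT.
  have [|t1 run1 le1] := IHp s.
    by rewrite wp; apply/allP=> b /stp; rewrite mem_cat negb_or => /andP[].
  have [|t2 run2 le2] := IHq (run p s).
    by rewrite wq; apply/allP=> b /stq; rewrite mem_cat negb_or => /andP[].
  exists (t1 + t2); first exact: ExecSeq run1 run2.
  apply: leq_add le1 (leq_trans le2 _); rewrite (@eq_in_time _ (reg s)) // => b /stq.
  by rewrite mem_cat negb_or => /andP[/regE_writes->].
- move=> e p IHp q IHq s /andP[/andP[wp wq] /allP st].
  have [|t1 run1 le1] := IHp s.
    rewrite wp; apply/allP=> b bp.
    by have := st b; rewrite !mem_cat bp negb_or => /(_ isT)/andP[].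
  have [|t2 run2 le2] := IHq s.
    rewrite wq; apply/allP=> b bq.
    by have := st b; rewrite !mem_cat bq orbT negb_or => /(_ isT)/andP[].
  case: (eqVneq (eval s e) 0) => [e0|e0].
    exists (cost e + t2).+1; first exact: ExecIfFalse.
    by rewrite ltnS leq_add2l; apply: leq_trans le2 (leq_addl _ _).
  exists (cost e + t1).+1; first exact: ExecIfTrue.
  by rewrite ltnS leq_add2l; apply: leq_trans le1 (leq_addr _ _).
move=> i b p IHp s; rewrite !inE /= => /andP[/andP[i_p wp] /andP[]].
rewrite negb_or => /andP[b_i b_p] /allP st.
have stp : all (fun b => b \notin writes p) (bounds p).
  by apply/allP=> r /st; rewrite inE negb_or => /andP[].
pose S k := iteri k (fun k st => run p (setr st i k)) s.
have regS k r : r \notin i :: writes p -> reg (S k) r = reg s r.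
  rewrite inE negb_or => /andP[/negbTE r_i r_p].
  by elim: k => //= k IHk; rewrite regE_writes //= /upd r_i.
(* Here [k] is the number of iterations left, so that the index stands at [reg s b - k]. *)
have loop k : k <= reg s b ->
    exists2 t, exec (While (Sub (Reg b) (Reg i))
                     (Seq (compile p) (Assign i (Add (Reg i) (Lit 1)))))
                 (setr (S (reg s b - k)) i (reg s b - k)) t (setr (S (reg s b)) i (reg s b))
    & t <= 4 + k * (time (reg s) p + 8).
  elim: k => [_|k IHk lt_k].
    rewrite subn0 mul0n; exists 4 => //.
    apply: (ExecWhileFalse (e := Sub (Reg b) (Reg i))) => /=.
    by rewrite /upd eqxx (negbTE b_i) regS ?subnn // inE negb_or b_i.
  have [t2 run2 le2] := IHk (ltnW lt_k).
  set l := reg s b - k.+1; have def_l : reg s b - k = l.+1 by lia.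
  have [|t1 run1 le1] := IHp (setr (S l) i l); first by rewrite wp.
  have reg_i : reg (run p (setr (S l) i l)) i = l by rewrite regE_writes //= /upd eqxx.
  exists (3 + (t1 + 4) + t2).+1; last first.
    suff: t1 <= time (reg s) p by lia.
    apply: leq_trans le1 _; rewrite (@eq_in_time _ (reg s)) // => r /st r_p /=.
    by rewrite /upd; case: eqP r_p => [->|_]; rewrite ?mem_head //; apply: regS.
  apply: (ExecWhileTrue (s1 := setr (S l.+1) i l.+1)).
  - by rewrite /= /upd eqxx (negbTE b_i) regS ?inE ?negb_or ?b_i // subn_eq0 -ltnNge; lia.
  - apply: ExecSeq run1 _.
    have := ExecAssign (run p (setr (S l) i l)) i (Add (Reg i) (Lit 1)).
    by rewrite [eval _ _]/= reg_i addn1.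
  - by rewrite -def_l.
have [t run_t le_t] := loop _ (leqnn _); rewrite subnn in run_t.
exists (2 + t); last by rewrite -[6]/(2 + 4) -addnA leq_add2l.
exact: ExecSeq (ExecAssign s i (Lit 0)) run_t.
Qed.

Lemma leq_time m M p : 0 < M -> (forall b, b \in bounds p -> m b <= M) ->
  time m p <= weight p * M ^ depth p.
Proof.
move=> M_gt0; have leM k l w : k <= l -> w * M ^ k <= w * M ^ l.
  by move=> le_kl; rewrite leq_mul // leq_pexp2l.
elim: p => //= [r e|a e|p IHp q IHq|e p IHp q IHq|i b p IHp] mM; rewrite ?muln1 //.
- rewrite mulnDl; apply: leq_add.
    apply: leq_trans (IHp _) (leM _ _ _ (leq_maxl _ _)) => b bp.
    by apply: mM; rewrite mem_cat bp.
  apply: leq_trans (IHq _) (leM _ _ _ (leq_maxr _ _)) => b bq.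
  by apply: mM; rewrite mem_cat bq orbT.
- rewrite -!addSn mulnDl; apply: leq_add; first by rewrite leq_pmulr // expn_gt0 M_gt0.
  rewrite mulnDl; apply: leq_add.
    apply: leq_trans (IHp _) (leM _ _ _ (leq_maxl _ _)) => b bp.
    by apply: mM; rewrite mem_cat bp.
  apply: leq_trans (IHq _) (leM _ _ _ (leq_maxr _ _)) => b bq.
  by apply: mM; rewrite mem_cat bq orbT.
have {}IHp : time m p <= weight p * M ^ depth p.
  by apply: IHp => r rp; apply: mM; rewrite in_cons rp orbT.
have mb : m b <= M by apply: mM; rewrite mem_head.
have gt0 : 0 < M ^ depth p by rewrite expn_gt0 M_gt0.
rewrite expnS; move: (M ^ depth p) gt0 IHp => K gt0 IHp.
have le_loop : m b * (time m p + 8) <= M * (weight p * K + 8).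
  by rewrite leq_mul ?leq_add2r.
rewrite [leqRHS]mulnDr mulnCA in le_loop.
have le_M : M * 1 <= M * K by rewrite leq_mul2l gt0 orbT.
move: (M * K) (m b * _) le_loop le_M => MK x le_loop le_M.
by rewrite mulnDl; move: (weight p * MK) le_loop => y; lia.
Qed.

(** Invariant rule for loops. Registers that the loop does not write are handed back unchanged, so
    invariants need not mention them. *)
Lemma run_for i b p s (I : nat -> state -> Prop) (Q : state -> Prop) :
  I 0 s ->
  (forall k st, k < reg s b ->
     (forall r, r \notin i :: writes p -> reg st r = reg s r) ->
     I k st -> I k.+1 (run p (setr st i k))) ->
  (forall st, (forall r, r \notin i :: writes p -> reg st r = reg s r) ->
     I (reg s b) st -> Q (setr st i (reg s b))) ->
  Q (run (LFor i b p) s).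
Proof.
move=> I0 IS IQ /=; move: (reg s b) IS IQ => n IS IQ.
set f := (fun k st => run p (setr st i k)).
have [frame In] : (forall r, r \notin i :: writes p -> reg (iteri n f s) r = reg s r)
    /\ I n (iteri n f s).
  have: n <= n by []; elim: {1 3 4 5}n => //= k IHk lt_k.
  have [frame Ik] := IHk (ltnW lt_k); split; last exact: IS.
  move=> r; rewrite inE negb_or => /andP[/negbTE r_i r_p].
  by rewrite regE_writes //= /upd r_i frame // inE r_i.
exact: IQ.
Qed.

Lemma reg_setr s r v r' : reg (setr s r v) r' = if r' == r then v else reg s r'.
Proof. by []. Qed.

Lemma memory_setr s r v : memory (setr s r v) = memory s.
Proof. by []. Qed.

Lemma reg_setm s a v : reg (setm s a v) = reg s.
Proof. by []. Qed.

Lemma memory_setm s a v b : memory (setm s a v) b = if b == a then v else memory s b.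
Proof. by []. Qed.

Lemma run_store a b s : run (LStore a b) s = setm s (eval s a) (eval s b).
Proof. by []. Qed.

Lemma run_assign r b s : run (LAssign r b) s = setr s r (eval s b).
Proof. by []. Qed.

Lemma run_seq p q s : run (LSeq p q) s = run q (run p s).
Proof. by []. Qed.

Lemma run_if b p q s : run (LIf b p q) s = if eval s b != 0 then run p s else run q s.
Proof. by []. Qed.

Definition setE := (reg_setr, memory_setr, reg_setm, memory_setm).

(* Otherwise rewriting with [setE] matches registers and memories up to
   unfolding. *)
Opaque setr setm.

(** * The search program *)

Definition pairs n := [seq (v, u) | v <- iota 0 n, u <- iota 0 n].

Lemma mem_pairs n p : (p \in pairs n) = (p.1 < n) && (p.2 < n).
Proof.
apply/allpairsP/andP=> [[[v u] /= [vn un ->]]|[v_n u_n]].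
  by rewrite !mem_iota in vn un.
by exists p; rewrite !mem_iota; case: p v_n u_n.
Qed.

Lemma pairs_uniq n : uniq (pairs n).
Proof.
apply: allpairs_uniq; rewrite ?iota_uniq // => -[v u] [v' u'] _ _ [-> ->] //.
Qed.

Lemma count_pairs n (Z : pred (nat * nat)) :
  count Z (pairs n) = #|[set p : 'I_n * 'I_n | Z (val p.1, val p.2)]|.
Proof.
pose f (p : 'I_n * 'I_n) := (val p.1, val p.2).
have f_inj : injective f by move=> [v u] [v' u'] [/val_inj-> /val_inj->].
have: perm_eq (pairs n) (map f (enum {: 'I_n * 'I_n})).
  apply: uniq_perm => [||[v u]]; first exact: pairs_uniq.
    by rewrite map_inj_uniq ?enum_uniq.
  rewrite mem_pairs /=; apply/andP/mapP => [[vn un]|[[v' u'] _ [-> ->]]]; last by rewrite !ltn_ord.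
  by exists (Ordinal vn, Ordinal un); rewrite ?mem_enum.
move/permP->; rewrite count_map -size_filter cardsE cardE /enum_mem -filter_predI.
by congr (size _); apply: eq_filter => p /=; rewrite !inE andbT.
Qed.

Lemma iota0S n : iota 0 n.+1 = rcons (iota 0 n) n.
Proof. by rewrite -addn1 iotaD add0n cats1. Qed.

(* Registers: 0 and 1 hold the input; 2 to 5 the base addresses; 6 a row
   offset; 7 to 9 loop bounds; 10 to 13 vertex indices; 14 and 15 the current
   candidate; 16 to 18 the extraction of its bits; 19 and 20 the ends of the
   chain (plus one); 21 a counter; 22 to 24 the best candidate so far. *)

(* Memory, with N = n * n: the edges from 0, the work matrix from N, the flags
   marking the vertices with incoming edges from 2N and with outgoing edges
   from 2N + n, and the row offsets v * n from 2N + 2n. *)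

(** The machine has no multiplication, so the offset of a row is looked up in a table. *)
Definition edge_addr v u := Add (Mem (Add (Reg 5) (Reg v))) (Reg u).
Definition edge_at v u := Mem (edge_addr v u).
Definition work_addr v u := Add (Reg 2) (edge_addr v u).
Definition work_at v u := Mem (work_addr v u).
Definition in_flag v := Mem (Add (Reg 3) (Reg v)).
Definition out_flag v := Mem (Add (Reg 4) (Reg v)).
Definition eq_test e1 e2 := Sub (Lit 1) (Add (Sub e1 e2) (Sub e2 e1)).

Definition for_pairs p := LFor 10 0 (LFor 11 0 p).

(** The invariant is indexed by the list of pairs already visited and has to be insensitive to the
    two index registers. *)
Lemma run_for_pairs n p s (I : seq (nat * nat) -> state -> Prop) (Q : state -> Prop) :
  reg s 0 = n -> 0 \notin writes p -> 10 \notin writes p ->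
  I [::] s ->
  (forall l st v u, v < n -> u < n -> reg st 10 = v -> reg st 11 = u ->
     (forall r, r \notin 10 :: 11 :: writes p -> reg st r = reg s r) ->
     I l st -> I (rcons l (v, u)) (run p st)) ->
  (forall l st r k, (r == 10) || (r == 11) -> I l st -> I l (setr st r k)) ->
  (forall st, (forall r, r \notin 10 :: 11 :: writes p -> reg st r = reg s r) ->
     I (pairs n) st -> Q st) ->
  Q (run (for_pairs p) s).
Proof.
move=> s0 p0 p10 I0 IS Iset IQ; rewrite /for_pairs.
pose J k := I [seq (v, u) | v <- iota 0 k, u <- iota 0 n].
apply: (@run_for _ _ _ _ J) => //; rewrite ?s0; last first.
  move=> st frame Jn; apply: IQ; last exact: Iset.
  move=> r rP; rewrite reg_setr; case: eqP rP => [->|_ rP]; first by rewrite mem_head.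
  exact: frame.
move=> k st lt_k frame Jk; set st1 := setr st 10 k.
have st1_0 : reg st1 0 = n by rewrite /st1 reg_setr /= frame // !inE.
pose K l := I ([seq (v, u) | v <- iota 0 k, u <- iota 0 n] ++ [seq (k, u) | u <- iota 0 l]).
apply: (@run_for _ _ _ _ K); rewrite ?st1_0 /K.
- by rewrite cats0; apply: Iset.
- move=> l st2 lt_l frame2 Kl.
  rewrite iota0S map_rcons -rcons_cat; apply: IS => //.
  + by rewrite reg_setr /= frame2 /st1 ?reg_setr // !inE p10.
  + move=> r rP; rewrite reg_setr; case: eqP rP => [->|_ rP].
      by rewrite !inE.
    have /norP[/negbTE r10 rP'] : ~~ ((r == 10) || (r \in 11 :: writes p)) by rewrite -in_cons.
    by rewrite frame2 // /st1 reg_setr r10 frame // in_cons r10.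
  + by apply: Iset.
move=> st2 _; rewrite /J iota0S -cats1 allpairs_cat /= cats0 => Kn.
exact: Iset.
Qed.

(** * Memory layout *)

Section Layout.
Variables (n : nat) (e : rel nat) (has_in has_out : pred nat).

(** Edges and flags are arbitrary predicates rather than those of an instance, so that the record
    also describes states in which they are only partly written. *)
Record layout (Z : pred (nat * nat)) (s : state) : Prop := Layout {
  layout_n : reg s 0 = n;
  layout_work : reg s 2 = n * n;
  layout_in : reg s 3 = (n * n).*2;
  layout_out : reg s 4 = (n * n).*2 + n;
  layout_row : reg s 5 = (n * n).*2 + n.*2;
  memory_edge v u : v < n -> u < n -> memory s (v * n + u) = e v u;
  memory_work v u : v < n -> u < n -> memory s (n * n + (v * n + u)) = Z (v, u);
  memory_in v : v < n -> memory s ((n * n).*2 + v) = has_in v;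
  memory_out v : v < n -> memory s ((n * n).*2 + n + v) = has_out v;
  memory_row v : v < n -> memory s ((n * n).*2 + n.*2 + v) = v * n }.

Lemma cell_bound v u : v < n -> u < n -> v * n + u < n * n.
Proof.
move=> vn un; apply: (@leq_trans (v.+1 * n)); first by rewrite mulSn addnC ltn_add2r.
by rewrite leq_mul2r vn orbT.
Qed.

Lemma cell_inj v u v' u' : u < n -> u' < n ->
  (v * n + u == v' * n + u') = (v == v') && (u == u').
Proof.
move=> un un'; apply/eqP/andP=> [E|[/eqP-> /eqP->] //].
have n_gt0 : 0 < n by apply: leq_trans un.
have := congr1 (divn^~ n) E; rewrite !divnMDl // !divn_small // !addn0 => ->.
have := congr1 (modn^~ n) E; rewrite !modnMDl !modn_small // => ->.
by rewrite !eqxx.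
Qed.

Lemma layout_setr Z s r v : r \notin [:: 0; 2; 3; 4; 5] ->
  layout Z s -> layout Z (setr s r v).
Proof.
rewrite !inE !negb_or => /and5P[r0 r2 r3 r4 r5] [*].
by split; rewrite ?reg_setr ?memory_setr // eq_sym ?(negbTE r0) ?(negbTE r2)
   ?(negbTE r3) ?(negbTE r4) ?(negbTE r5).
Qed.

Lemma eq_layout Z Z' s : {in pairs n, Z =1 Z'} -> layout Z s -> layout Z' s.
Proof.
move=> ZZ' [*]; split=> // v u vn un; rewrite -ZZ'; first by auto.
by rewrite mem_pairs /= vn.
Qed.

Lemma layout_setm Z s v u (b : bool) : v < n -> u < n -> layout Z s ->
  layout (fun p => if p == (v, u) then b else Z p) (setm s (n * n + (v * n + u)) b).
Proof.
move=> vn un [s0 s2 s3 s4 s5 mE mW mI mO mR]; have := cell_bound vn un.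
have inj v' u' := @cell_inj v' u' v u.
split=> // [v' u' vn' un'|v' u' vn' un'|v' vn'|v' vn'|v' vn']; rewrite memory_setm.
- by rewrite (negbTE (_ : _ != _)) ?mE //; have := cell_bound vn' un'; lia.
- by rewrite eqn_add2l inj // xpair_eqE; case: ifP => // _; rewrite mW.
- by rewrite (negbTE (_ : _ != _)) ?mI //; lia.
- by rewrite (negbTE (_ : _ != _)) ?mO //; lia.
- by rewrite (negbTE (_ : _ != _)) ?mR //; lia.
Qed.

Lemma eval_mem s a : eval s (Mem a) = memory s (eval s a).
Proof. by []. Qed.

Lemma eval_add s a b : eval s (Add a b) = eval s a + eval s b.
Proof. by []. Qed.

Lemma eval_sub s a b : eval s (Sub a b) = eval s a - eval s b.
Proof. by []. Qed.

Lemma eval_reg s r : eval s (Reg r) = reg s r.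
Proof. by []. Qed.

Section Eval.
Variables (Z : pred (nat * nat)) (s : state).
Hypothesis sZ : layout Z s.

Lemma eval_edge_addr a b : reg s a < n -> eval s (edge_addr a b) = reg s a * n + reg s b.
Proof. by move=> an; rewrite /= (layout_row sZ) (memory_row sZ). Qed.

Lemma eval_edge_at a b : reg s a < n -> reg s b < n ->
  eval s (edge_at a b) = e (reg s a) (reg s b).
Proof.
by move=> an bn; rewrite eval_mem eval_edge_addr // (memory_edge sZ).
Qed.

Lemma eval_work_addr a b : reg s a < n ->
  eval s (work_addr a b) = n * n + (reg s a * n + reg s b).
Proof.
by move=> an; rewrite eval_add eval_reg eval_edge_addr // (layout_work sZ).
Qed.

Lemma eval_work_at a b : reg s a < n -> reg s b < n ->
  eval s (work_at a b) = Z (reg s a, reg s b).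
Proof.
by move=> an bn; rewrite eval_mem eval_work_addr // (memory_work sZ).
Qed.

Lemma eval_in_flag a : reg s a < n -> eval s (in_flag a) = has_in (reg s a).
Proof. by move=> an; rewrite /= (layout_in sZ) (memory_in sZ). Qed.

Lemma eval_out_flag a : reg s a < n -> eval s (out_flag a) = has_out (reg s a).
Proof. by move=> an; rewrite /= (layout_out sZ) (memory_out sZ). Qed.

End Eval.

Lemma eval_eq_test s e1 e2 : eval s (eq_test e1 e2) = (eval s e1 == eval s e2).
Proof. by rewrite /=; lia. Qed.

Opaque edge_addr edge_at work_addr work_at in_flag out_flag eq_test.

Fixpoint storeless (p : lprog) : bool :=
  match p with
  | LSkip | LAssign _ _ => true
  | LStore _ _ => false
  | LSeq p q | LIf _ p q => storeless p && storeless q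
  | LFor _ _ p => storeless p
  end.

Lemma memory_storeless p s : storeless p -> memory (run p s) = memory s.
Proof.
elim: p s => //= [p IHp q IHq|b p IHp q IHq|i b p IHp] s.
- by case/andP=> /IHp Ep /IHq->.
- by case/andP=> /IHp Ep /IHq Eq; case: ifP.
move=> /IHp Ep; change (memory (iteri (reg s b) (fun k st => run p (setr st i k)) s) = memory s).
by elim: (reg s b) => //= k IHk; rewrite Ep.
Qed.

Lemma layout_run p Z s : storeless p ->
  all (fun r => r \notin writes p) [:: 0; 2; 3; 4; 5] -> layout Z s -> layout Z (run p s).
Proof.
move=> p_storeless /and5P[w0 w2 w3 w4 /andP[w5 _]] [*].
by split; rewrite ?memory_storeless // regE_writes.
Qed.

(** * Construction of a candidate *)

Definition clear := for_pairs (LStore (work_addr 10 11) (Lit 0)).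

Lemma run_clear Z s : layout Z s -> layout pred0 (run clear s).
Proof.
move=> sZ.
apply: (@run_for_pairs n _ _ (fun l st => exists2 Z, layout Z st & forall p, p \in l -> Z p = false)).
- exact: layout_n sZ.
- by [].
- by [].
- by exists Z.
- move=> l st v u vn un st_v st_u _ [Z1 stZ1 Z1l].
  exists (fun p => if p == (v, u) then false else Z1 p).
    rewrite run_store (eval_work_addr stZ1) st_v // st_u.
    exact: (layout_setm false).
  move=> p; rewrite mem_rcons in_cons; case: eqP => //= _; exact: Z1l.
- move=> l st r k r_k [Z1 stZ1 Z1l]; exists Z1 => //; apply: layout_setr stZ1.
  by case/orP: r_k => /eqP->.
move=> st _ [Z1 stZ1 Z1l]; apply: eq_layout stZ1 => p; exact: Z1l.
Qed.

Definition isolated_nat v := ~~ has_in v && ~~ has_out v.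
Definition chain_of m w := [seq v <- iota 0 m | (v < w) && isolated_nat v].
Definition links (c : seq nat) : pred (nat * nat) := fun p => p \in zip c (behead c).

Lemma links_rcons c v p :
  links (rcons c v) p = links c p || (c != [::]) && (p == (last 0 c, v)).
Proof.
rewrite /links; elim: c => //= a [|b c] IHc; first by rewrite inE.
by rewrite /= in_cons IHc /= in_cons orbA.
Qed.

(** The shift by one frees 0 to stand for the empty chain, which then agrees with no vertex. *)
Definition succ_head (c : seq nat) := if c is a :: _ then a.+1 else 0.
Definition succ_last (c : seq nat) := if c is a :: c' then (last a c').+1 else 0.

Definition chain_step :=
  LIf (Sub (Reg 14) (Reg 10))
    (LIf (Add (in_flag 10) (out_flag 10)) LSkip
       (LSeq
          (LIf (Reg 20)
             (LSeq (LAssign 20 (Sub (Reg 20) (Lit 1))) (LStore (work_addr 20 10) (Lit 1)))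
             (LAssign 19 (Add (Reg 10) (Lit 1))))
          (LAssign 20 (Add (Reg 10) (Lit 1)))))
    LSkip.

Definition build_chain :=
  LSeq (LAssign 19 (Lit 0)) (LSeq (LAssign 20 (Lit 0)) (LFor 10 0 chain_step)).

Lemma run_build_chain s (c := chain_of n (reg s 14)) : layout pred0 s ->
  [/\ layout (links c) (run build_chain s), reg (run build_chain s) 19 = succ_head c
    & reg (run build_chain s) 20 = succ_last c].
Proof.
move=> s0; set s1 := setr (setr s 19 0) 20 0.
pose Q st := [/\ layout (links c) st, reg st 19 = succ_head c & reg st 20 = succ_last c].
change (Q (run (LFor 10 0 chain_step) s1)).
have s1_n : reg s1 0 = n by rewrite /s1 !setE (layout_n s0).
pose J k st := let c := chain_of k (reg s 14) in
  [/\ layout (links c) st, reg st 19 = succ_head c & reg st 20 = succ_last c].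
apply: (@run_for _ _ _ _ J); rewrite ?s1_n.
- by split; rewrite ?setE //; do 2 apply: layout_setr => //.
- move=> k st lt_k frame [stZ st19 st20]; set st1 := setr st 10 k.
  have st1Z : layout (links (chain_of k (reg s 14))) st1 by apply: layout_setr.
  have st1_10 : reg st1 10 = k by rewrite /st1 setE.
  have st1_14 : reg st1 14 = reg s 14 by rewrite /st1 setE /= frame // /s1 !setE.
  have st1_19 : reg st1 19 = succ_head (chain_of k (reg s 14)) by rewrite /st1 setE.
  have st1_20 : reg st1 20 = succ_last (chain_of k (reg s 14)) by rewrite /st1 setE.
  rewrite /J /chain_of iota0S filter_rcons -/(chain_of k _); clearbody st1.
  have -> : run chain_step st1 =
    if (k < reg s 14) && isolated_nat k then
      let st2 := if reg st1 20 != 0 then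
                   let st2 := setr st1 20 (reg st1 20 - 1) in
                   setm st2 (eval st2 (work_addr 20 10)) 1
                 else setr st1 19 k.+1 in
      setr st2 20 k.+1
    else st1.
    rewrite /chain_step !run_if eval_sub !eval_reg st1_14 st1_10 subn_eq0 -ltnNge.
    rewrite eval_add (eval_in_flag st1Z) ?(eval_out_flag st1Z) ?st1_10 //.
    rewrite /isolated_nat !run_seq run_if; case: (_ < _) => //.
    case: (has_in k); case: (has_out k) => //.
    by case: (reg st1 20 =P 0) => [st1_0|/eqP st1_0];
      rewrite /= ?st1_0 /= !setE /= ?st1_0 st1_10 addn1.
  case: ifP => [_|_]; last by split.
  case Ec: (chain_of k (reg s 14)) => [|a c'] in st1Z st1_19 st1_20 *.
    rewrite st1_20 /= !setE /=; split=> //.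
    by do 2 apply: layout_setr => //.
  rewrite st1_20 /= subn1 /=; set st2 := setr st1 20 _.
  have st2Z : layout (links (a :: c')) st2 by apply: layout_setr.
  have last_n : last a c' < n.
    have: last a c' \in chain_of k (reg s 14) by rewrite Ec mem_last.
    by rewrite mem_filter mem_iota => /and3P[_ _ /leq_trans]; apply; apply: ltnW.
  rewrite (eval_work_addr st2Z) /st2 !setE //= st1_10 last_rcons.
  split=> //; apply: layout_setr => //.
  have := layout_setm true last_n lt_k st2Z; apply: eq_layout => p _.
  by rewrite -rcons_cons links_rcons /=; case: eqP => _; rewrite ?orbT ?orbF.
move=> st _ [stZ st19 st20]; rewrite /Q !setE; split=> //.
exact: layout_setr.
Qed.

(** Parity and half by repeated subtraction of 2. Register 9 exceeds every candidate number, so it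
    bounds the number of rounds; the test succeeds as long as the value is at least 2. *)
Definition halve :=
  LSeq (LAssign 17 (Lit 0))
    (LFor 18 9
       (LIf (Sub (Reg 16) (Lit 1))
          (LSeq (LAssign 16 (Sub (Reg 16) (Lit 2))) (LAssign 17 (Add (Reg 17) (Lit 1))))
          LSkip)).

Lemma run_halve s : reg s 16 <= reg s 9 ->
  reg (run halve s) 16 = odd (reg s 16) /\ reg (run halve s) 17 = (reg s 16)./2.
Proof.
move=> le_s; set y := reg s 16.
pose Q st := reg st 16 = odd y /\ reg st 17 = y./2.
rewrite /halve run_seq run_assign; set s1 := setr s 17 _.
pose J k st := reg st 16 = y - (minn k y./2).*2 /\ reg st 17 = minn k y./2.
have s1_9 : reg s1 9 = reg s 9 by rewrite /s1 setE.
apply: (@run_for _ _ _ _ J Q); rewrite ?s1_9.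
- by rewrite /J min0n subn0 /s1 !setE.
- move=> k st lt_k _ [st16 st17]; rewrite /J run_if run_seq !run_assign /= !setE /= st16.
  by case: ifP => le1; rewrite !setE /= ?st16 ?st17; split; lia.
move=> st _ [st16 st17]; rewrite /Q !setE /= st16 st17.
by have := odd_double_half y; split; lia.
Qed.

Definition pick_bit :=
  LSeq halve (LSeq (LIf (Reg 16) (LStore (work_addr 10 11) (Lit 1)) LSkip)
                   (LAssign 16 (Reg 17))).

Definition pick_step :=
  LIf (out_flag 10) LSkip (LIf (in_flag 11) LSkip
    (LIf (Add (in_flag 10) (eq_test (Reg 20) (Add (Reg 10) (Lit 1))))
       (LIf (Add (out_flag 11) (eq_test (Reg 19) (Add (Reg 11) (Lit 1)))) pick_bit LSkip)
       LSkip)).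

Definition pick := LSeq (LAssign 16 (Reg 15)) (for_pairs pick_step).

(** Among vertices without outgoing edges the isolated ones are those without incoming edges, and
    symmetrically; this turns the implications of [chain_cand] into disjunctions. *)
Definition cand_nat (c : seq nat) (p : nat * nat) :=
  [&& ~~ has_out p.1, ~~ has_in p.2, has_in p.1 || chain_tail c p.1
    & has_out p.2 || chain_head c p.2].

(** A binary digit is consumed only at an admissible pair. The number of digits is thus bounded in
    terms of the parameter, while one digit per pair of vertices would require [n * n] of them. *)
Definition take_bit c (st : nat * seq (nat * nat)) p :=
  if cand_nat c p then (st.1./2, if odd st.1 then p :: st.2 else st.2) else st.
Definition take_bits c x l := foldl (take_bit c) (x, [::]) l.

(* The candidate numbered [(w, x)] is the path on the isolated vertices below [w],
   together with the admissible pairs selected by the binary digits of [x]. *)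
Definition candidate w x : pred (nat * nat) :=
  [pred p | (p \in (take_bits (chain_of n w) x (pairs n)).2) || links (chain_of n w) p].

Lemma eq_succ_last c v : (succ_last c == v.+1) = chain_tail c v.
Proof. by case: c => //= a c; rewrite eqSS eq_sym. Qed.

Lemma eq_succ_head c v : (succ_head c == v.+1) = chain_head c v.
Proof. by case: c => //= a c; rewrite eqSS eq_sym. Qed.

Lemma run_pick_step Z s v u c : v < n -> u < n -> layout Z s ->
  reg s 10 = v -> reg s 11 = u -> reg s 19 = succ_head c -> reg s 20 = succ_last c ->
  reg s 16 <= reg s 9 ->
  run pick_step s = if cand_nat c (v, u) then run pick_bit s else s.
Proof.
move=> vn un sZ s10 s11 s19 s20 le_s.
rewrite /pick_step !run_if !eval_add !eval_eq_test !eval_add !eval_reg s19 s20.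
rewrite !(eval_in_flag sZ) ?s10 ?s11 // !(eval_out_flag sZ) ?s10 ?s11 //.
rewrite !addn1 eq_succ_last eq_succ_head /cand_nat /=.
case: (has_out v) => //=; case: (has_in u) => //=.
by case: (has_in v); case: (has_out u); case: (chain_tail c v); case: (chain_head c u).
Qed.

Lemma run_pick_bit Z s v u : v < n -> u < n -> layout Z s ->
  reg s 10 = v -> reg s 11 = u -> reg s 16 <= reg s 9 ->
  layout (fun p => odd (reg s 16) && (p == (v, u)) || Z p) (run pick_bit s) /\
  reg (run pick_bit s) 16 = (reg s 16)./2.
Proof.
move=> vn un sZ s10 s11 /run_halve[]; rewrite /pick_bit 2!run_seq.
have: layout Z (run halve s) by apply: layout_run.
have: reg (run halve s) 10 = v by rewrite regE_writes.
have: reg (run halve s) 11 = u by rewrite regE_writes.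
move: (run halve s) => s1 s1_11 s1_10 s1Z s1_16 s1_17.
rewrite run_if eval_reg run_assign eval_reg setE /= s1_16.
case: (odd _) => /=.
  rewrite (eval_work_addr s1Z) s1_10 // s1_11 setE s1_17; split=> //.
  apply: layout_setr => //; apply: eq_layout (layout_setm true vn un s1Z) => p _.
  by case: eqP.
by rewrite s1_17; split=> //; apply: layout_setr.
Qed.

Lemma take_bits_rcons c x l p :
  take_bits c x (rcons l p) = take_bit c (take_bits c x l) p.
Proof. by rewrite /take_bits -cats1 foldl_cat. Qed.

Lemma run_pick Z s c : layout Z s -> reg s 15 <= reg s 9 ->
  reg s 19 = succ_head c -> reg s 20 = succ_last c ->
  layout (fun p => (p \in (take_bits c (reg s 15) (pairs n)).2) || Z p) (run pick s).
Proof.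
move=> sZ le_s s19 s20; rewrite /pick run_seq run_assign eval_reg; set s1 := setr s 16 _.
pose J l st := [/\ layout (fun p => (p \in (take_bits c (reg s 15) l).2) || Z p) st,
  reg st 16 = (take_bits c (reg s 15) l).1 & reg st 16 <= reg s 9].
apply: (@run_for_pairs n _ _ J) => //.
- by rewrite /s1 setE (layout_n sZ).
- by split; rewrite /s1 ?setE //; apply: layout_setr.
- move=> l st v u vn un st10 st11 frame [stZ st16 le16].
  have [st19 st20 st9] : [/\ reg st 19 = succ_head c, reg st 20 = succ_last c & reg st 9 = reg s 9].
    by split; rewrite frame // /s1 setE.
  rewrite -st9 in le16.
  rewrite (run_pick_step vn un stZ st10 st11 st19 st20 le16) /J take_bits_rcons /take_bit.
  case: ifP => _; last by split=> //; rewrite -st9.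
  have [stZ' ->] := run_pick_bit vn un stZ st10 st11 le16.
  rewrite st16 /=; split=> //.
    rewrite st16 in stZ'; apply: eq_layout stZ' => p _.
    by case: (odd _) => //=; rewrite in_cons orbA.
  by rewrite -st9 -st16; apply: leq_trans le16; lia.
- move=> l st r k r_k [stZ st16 le16]; split; rewrite ?setE.
  + by apply: layout_setr stZ; case/orP: r_k => /eqP->.
  + by case/orP: r_k => /eqP->.
  + by case/orP: r_k => /eqP->.
by move=> st _ [].
Qed.

Definition build := LSeq clear (LSeq build_chain pick).

Lemma run_build Z s : layout Z s -> reg s 15 <= reg s 9 ->
  layout (candidate (reg s 14) (reg s 15)) (run build s).
Proof.
move=> sZ le_s; rewrite /build 2!run_seq.
have := run_clear sZ; have: reg (run clear s) 14 = reg s 14 by rewrite regE_writes.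
have: reg (run clear s) 15 = reg s 15 by rewrite regE_writes.
have: reg (run clear s) 9 = reg s 9 by rewrite regE_writes.
move: (run clear s) => s1 s1_9 s1_15 s1_14 /run_build_chain[].
have: reg (run build_chain s1) 15 = reg s 15 by rewrite regE_writes.
have: reg (run build_chain s1) 9 = reg s 9 by rewrite regE_writes.
rewrite s1_14; move: (run build_chain s1) => s2 s2_9 s2_15 s2Z s2_19 s2_20.
have := run_pick s2Z _ s2_19 s2_20; rewrite s2_9 s2_15 => /(_ le_s).
by apply: eq_layout.
Qed.

(** * Evaluation of a candidate: size and transitive closure *)

Definition count_work :=
  LSeq (LAssign 21 (Lit 0))
    (for_pairs (LIf (work_at 10 11) (LAssign 21 (Add (Reg 21) (Lit 1))) LSkip)).

Lemma run_count Z s : layout Z s ->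
  layout Z (run count_work s) /\ reg (run count_work s) 21 = count Z (pairs n).
Proof.
move=> sZ; split; first by apply: layout_run.
rewrite /count_work run_seq run_assign; set s1 := setr s 21 _.
pose J l st := layout Z st /\ reg st 21 = count Z l.
apply: (@run_for_pairs n _ _ J (fun st => reg st 21 = count Z (pairs n))) => //.
- by rewrite /s1 setE (layout_n sZ).
- by split; rewrite /s1 ?setE //; apply: layout_setr.
- move=> l st v u vn un st10 st11 _ [stZ st21].
  rewrite run_if (eval_work_at stZ) ?st10 ?st11 // run_assign /= st21 /J -cats1 count_cat /=.
  case: (Z (v, u)) => /=; last by rewrite !addn0.
  by rewrite addn0 setE; split=> //; apply: layout_setr.
- move=> l st r k r_k [stZ st21]; rewrite /J setE.
  by case/orP: r_k => /eqP->; split=> //; apply: layout_setr.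
by move=> st _ [].
Qed.

Definition add_edges :=
  for_pairs (LIf (Add (edge_at 10 11) (eq_test (Reg 10) (Reg 11)))
               (LStore (work_addr 10 11) (Lit 1)) LSkip).

Definition refl_graph (Z : pred (nat * nat)) : pred (nat * nat) :=
  [pred p | [|| Z p, e p.1 p.2 | p.1 == p.2]].

Lemma run_add_edges Z s : layout Z s -> layout (refl_graph Z) (run add_edges s).
Proof.
move=> sZ.
pose J (l : seq (nat * nat)) st := layout (fun p => Z p || (p \in l) && (e p.1 p.2 || (p.1 == p.2))) st.
apply: (@run_for_pairs n _ _ J (layout (refl_graph Z))) => //.
- exact: layout_n sZ.
- by apply: eq_layout sZ => p _; rewrite orbF.
- move=> l st v u vn un st10 st11 _ stZ; rewrite /J.
  have rconsE p : (p \in rcons l (v, u)) && (e p.1 p.2 || (p.1 == p.2)) =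
      (p == (v, u)) && (e v u || (v == u)) || (p \in l) && (e p.1 p.2 || (p.1 == p.2)).
    by rewrite mem_rcons in_cons; case: eqP => [->|] //=; case: (e v u || _); rewrite ?andbT ?andbF.
  rewrite run_if eval_add (eval_edge_at stZ) ?st10 ?st11 // eval_eq_test !eval_reg st10 st11.
  rewrite (_ : _ != 0 = (e v u || (v == u))); last by case: (e v u); case: (v == u).
  case: ifP => [vu|nvu]; last first.
    by apply: eq_layout stZ => p _; rewrite rconsE nvu andbF.
  rewrite run_store (eval_work_addr stZ) st10 // st11.
  apply: eq_layout (layout_setm true vn un stZ) => p _.
  by rewrite rconsE vu; case: eqP; rewrite ?orbT.
- by move=> l st r k r_k stZ; apply: layout_setr stZ; case/orP: r_k => /eqP->.
by move=> st _; apply: eq_layout => p /= ->.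
Qed.

Definition relax := LIf (work_at 10 11)
  (LIf (work_at 11 12) (LStore (work_addr 10 12) (Lit 1)) LSkip) LSkip.
Definition closure_round := for_pairs (LFor 12 0 relax).
Definition closure_prog := LFor 13 0 closure_round.

(** Soundness of updates in place: [Z'] contains [Z] and stays inside every transitive relation that
    contains [Z]. In this form it composes along loops. *)
Definition extends (Z Z' : pred (nat * nat)) :=
  subpred Z Z' /\ forall r : rel nat, transitive r ->
    (forall v u, v < n -> u < n -> Z (v, u) -> r v u) ->
    forall v u, v < n -> u < n -> Z' (v, u) -> r v u.

Lemma extends_refl Z : extends Z Z.
Proof. by split. Qed.

Lemma extends_trans Z1 Z2 Z3 : extends Z1 Z2 -> extends Z2 Z3 -> extends Z1 Z3.
Proof.
move=> [s12 r12] [s23 r23]; split=> [p /s12/s23 //|r r_trans Z1r].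
by apply: r23 => //; apply: r12.
Qed.

Lemma run_relax Z s v u t : v < n -> u < n -> t < n -> layout Z s ->
    reg s 10 = v -> reg s 11 = u -> reg s 12 = t ->
  exists Z', [/\ layout Z' (run relax s), extends Z Z'
                 & Z (v, u) -> Z (u, t) -> Z' (v, t)].
Proof.
move=> vn un tn sZ s10 s11 s12; rewrite /relax !run_if run_store.
rewrite !(eval_work_at sZ) ?(eval_work_addr sZ) ?s10 ?s11 ?s12 //.
case Zvu: (Z (v, u)); last by exists Z; split=> //; apply: extends_refl.
case Zut: (Z (u, t)); last by exists Z; split=> //; apply: extends_refl.
exists (fun p => if p == (v, t) then true else Z p); split; last by rewrite eqxx.
  exact: layout_setm true vn tn sZ.
split=> [p Zp|r r_trans Zr v' t' v'n t'n]; first by case: ifP.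
by case: eqP => [[-> ->] _|_]; [apply: r_trans (Zr v u _ _ _) (Zr u t _ _ _)|apply: Zr].
Qed.

Lemma run_closure_round Z s : layout Z s ->
  exists Z', [/\ layout Z' (run closure_round s), extends Z Z'
    & forall v u t, v < n -> u < n -> t < n -> Z (v, u) -> Z (u, t) -> Z' (v, t)].
Proof.
move=> sZ.
pose J (l : seq (nat * nat)) st := exists Z', [/\ layout Z' st, extends Z Z'
  & forall v u t, (v, u) \in l -> t < n -> Z (v, u) -> Z (u, t) -> Z' (v, t)].
pose Q st := exists Z', [/\ layout Z' st, extends Z Z'
  & forall v u t, v < n -> u < n -> t < n -> Z (v, u) -> Z (u, t) -> Z' (v, t)].
apply: (@run_for_pairs n _ _ J Q) => //.
- exact: layout_n sZ.
- by exists Z; split=> //; apply: extends_refl.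
- move=> l st v u vn un st10 st11 _ [Z1 [stZ1 ZZ1 Z1l]].
  pose K k st := exists Z', [/\ layout Z' st, extends Z1 Z'
    & forall t, t < k -> Z (v, u) -> Z (u, t) -> Z' (v, t)].
  apply: (@run_for _ _ _ _ K); rewrite ?(layout_n stZ1).
  + by exists Z1; split=> //; apply: extends_refl.
  + move=> t st1 tn frame [Z2 [st1Z2 Z12 Z2t]].
    have st2Z2 : layout Z2 (setr st1 12 t) by apply: layout_setr.
    have [|||Z3 [st3Z3 Z23 Z3t]] := run_relax vn un tn st2Z2.
    * by rewrite setE /= frame.
    * by rewrite setE /= frame.
    * by rewrite setE.
    exists Z3; split=> //; first exact: extends_trans Z23.
    move=> t'; rewrite ltnS leq_eqVlt => /predU1P[->|lt_t'] Zvu Zut.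
      by apply: Z3t; apply: (proj1 Z12); apply: (proj1 ZZ1).
    by apply: (proj1 Z23); apply: Z2t.
  move=> st1 _ [Z2 [st1Z2 Z12 Z2t]]; exists Z2; split.
  + exact: layout_setr.
  + exact: extends_trans Z12.
  + move=> v' u' t; rewrite mem_rcons in_cons => /predU1P[[-> ->]|l_vu] tn Zvu Zut.
      exact: Z2t.
    by apply: (proj1 Z12); apply: Z1l l_vu _ _ _.
- move=> l st r k r_k [Z1 [stZ1 ZZ1 Z1l]]; exists Z1; split=> //.
  by apply: layout_setr stZ1; case/orP: r_k => /eqP->.
move=> st _ [Z1 [stZ1 ZZ1 Z1l]]; exists Z1; split=> // v u t vn un.
by apply: Z1l; rewrite mem_pairs /= vn.
Qed.

(** Each round accounts for paths with one more edge, by joining what is known about a path without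
    its last edge to that edge; paths without edges are covered by the diagonal. *)
Lemma run_closure Z s : layout Z s -> (forall v, v < n -> Z (v, v)) ->
  exists Z', [/\ layout Z' (run closure_prog s), extends Z Z'
    & forall v p, path (fun a b => Z (a, b)) v p -> all (gtn n) (v :: p) ->
        size p <= n -> Z' (v, last v p)].
Proof.
move=> sZ Zrefl.
pose J k st := exists Z', [/\ layout Z' st, extends Z Z'
  & forall v p, path (fun a b => Z (a, b)) v p -> all (gtn n) (v :: p) ->
      size p <= k -> Z' (v, last v p)].
apply: (@run_for _ _ _ _ J (fun st => exists Z', [/\ layout Z' st, extends Z Z' & _]));
  rewrite ?(layout_n sZ).
- exists Z; split=> //; first exact: extends_refl.
  by move=> v [|//] _ /andP[/Zrefl].
- move=> k st lt_k _ [Z1 [stZ1 ZZ1 Z1k]].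
  have [|Z2 [st2 Z12 Z2P]] := @run_closure_round Z1 (setr st 13 k); first exact: layout_setr.
  exists Z2; split=> //; first exact: extends_trans Z12.
  move=> v p; case/lastP: p => [|p t].
    by move=> _ /andP[vn _] _; apply: (proj1 Z12); apply: (proj1 ZZ1); apply: Zrefl.
  rewrite rcons_path last_rcons -rcons_cons all_rcons size_rcons.
  move=> /andP[vp Zt] /andP[tn vpn] le_p.
  have vn : v < n by case/andP: vpn.
  have last_n : last v p < n by apply: (allP vpn); apply: mem_last.
  by apply: Z2P vn last_n tn (Z1k _ _ vp vpn le_p) _; apply: (proj1 ZZ1).
move=> st _ [Z1 [stZ1 ZZ1 Z1k]]; exists Z1; split=> //; exact: layout_setr.
Qed.

Local Arguments run : simpl never.

Definition candidate_graph (Z : pred (nat * nat)) : rel 'I_n :=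
  fun a b => e a b || Z (val a, val b).

Lemma closure_connect Z Z' : extends (refl_graph Z) Z' ->
    (forall v p, path (fun a b => refl_graph Z (a, b)) v p -> all (gtn n) (v :: p) ->
       size p <= n -> Z' (v, last v p)) ->
  forall a b : 'I_n, Z' (val a, val b) = connect (candidate_graph Z) a b.
Proof.
move=> [_ sound] complete a b; apply/idP/idP => [Zab|/connectP[p ap ->]].
  (* Reachability carried over to [nat], where the soundness clause expects its transitive
     relation. *)
  pose r v u := [exists a : 'I_n, exists b : 'I_n,
    [&& val a == v, val b == u & connect (candidate_graph Z) a b]].
  have rP (a' b' : 'I_n) : r a' b' = connect (candidate_graph Z) a' b'.
    apply/existsP/idP => [[c /existsP[d /and3P[/eqP/val_inj-> /eqP/val_inj->]]] //|ab].
    by exists a'; apply/existsP; exists b'; rewrite !eqxx.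
  rewrite -rP; apply: sound => // [u v w|v u vn un].
    case/existsP=> x /existsP[y /and3P[/eqP<- /eqP<- xy]].
    case/existsP=> y' /existsP[z /and3P[/eqP/val_inj-> /eqP<- yz]].
    by rewrite rP; apply: connect_trans xy yz.
  move=> Zvu; rewrite -[v]/(val (Ordinal vn)) -[u]/(val (Ordinal un)) rP.
  case/or3P: Zvu => [Zvu|evu|/eqP vu].
  - by apply: connect1; rewrite /candidate_graph /= Zvu orbT.
  - by apply: connect1; rewrite /candidate_graph /= [e v u]evu.
  - by rewrite (_ : Ordinal vn = Ordinal un) //; apply: val_inj.
(* After [n] rounds only paths with at most [n] edges are covered; a path without repeated vertices
   has fewer. *)
case/shortenP: ap => q aq q_uniq _; rewrite -last_map; apply: complete.
- rewrite path_map; apply: sub_path aq => x y; rewrite /candidate_graph /refl_graph /=.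
  by case/orP=> ->; rewrite ?orbT.
- by rewrite -map_cons; apply/allP=> _ /mapP[x _ ->]; apply: ltn_ord.
- rewrite size_map; apply: ltnW; have := max_card (mem (a :: q)).
  by rewrite (card_uniqP q_uniq) card_ord.
Qed.

Variable B : nat.

Definition fits w x := count (candidate w x) (pairs n) <= B.
Definition value w x :=
  #|[set p : 'I_n * 'I_n | connect (candidate_graph (candidate w x)) p.1 p.2]|.

Definition keep_best := LIf (Sub (Reg 21) (Reg 22))
  (LSeq (LAssign 22 (Reg 21)) (LSeq (LAssign 23 (Reg 14)) (LAssign 24 (Reg 15)))) LSkip.
Definition measure := LSeq add_edges (LSeq closure_prog count_work).
Definition evaluate :=
  LSeq build (LSeq count_work
    (LIf (Sub (Add (Reg 1) (Lit 1)) (Reg 21)) (LSeq measure keep_best) LSkip)).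

Lemma run_measure Z s : layout Z s ->
  (exists Z', layout Z' (run measure s)) /\ reg (run measure s) 21 =
     #|[set p : 'I_n * 'I_n | connect (candidate_graph Z) p.1 p.2]|.
Proof.
move=> sZ; rewrite /measure 2!run_seq; have := run_add_edges sZ.
move: (run add_edges s) => s1 /run_closure[|Z' [s2Z' ext complete]].
  by move=> v _; rewrite /refl_graph /= eqxx !orbT.
have [s3Z' ->] := run_count s2Z'; split; first by exists Z'.
rewrite count_pairs; congr #|pred_of_set _|; apply/setP=> p.
by rewrite !inE (closure_connect ext complete).
Qed.

Lemma run_evaluate Z s (w := reg s 14) (x := reg s 15) (s' := run evaluate s) :
  layout Z s -> reg s 15 <= reg s 9 -> reg s 1 = B ->
  (exists Z', layout Z' s') /\
  if fits w x && (reg s 22 < value w x)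
  then [/\ reg s' 22 = value w x, reg s' 23 = w & reg s' 24 = x]
  else [/\ reg s' 22 = reg s 22, reg s' 23 = reg s 23 & reg s' 24 = reg s 24].
Proof.
move=> sZ le_s s_B; rewrite /s' /evaluate 2!run_seq.
have := run_build sZ le_s.
have := @regE_all build s [:: 1; 14; 15; 22; 23; 24] isT.
move: (run build s) => s1 s1E /run_count[].
have: {in [:: 1; 14; 15; 22; 23; 24], forall r, reg (run count_work s1) r = reg s r}.
  by move=> r rP; rewrite -s1E //; apply: (@regE_all count_work s1 [:: 1; 14; 15; 22; 23; 24]).
move: (run count_work s1) => {}s1 {}s1E s1Z s1_21.
rewrite run_if eval_sub eval_add !eval_reg s1_21 s1E // s_B [eval _ (Lit 1)]/= addn1 subn_eq0 -ltnNge ltnS.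
rewrite -/(fits w x); case: ifP => _; last by split; [exists (candidate w x)|rewrite !s1E].
rewrite run_seq; have [] := run_measure s1Z; rewrite -/(value w x).
have: {in [:: 1; 14; 15; 22; 23; 24], forall r, reg (run measure s1) r = reg s r}.
  by move=> r rP; rewrite -s1E //; apply: (@regE_all measure s1 [:: 1; 14; 15; 22; 23; 24]).
move: (run measure s1) => {s1E s1Z s1_21} s2 s2E [Z2 s2Z] s2_21.
rewrite /keep_best run_if eval_sub !eval_reg s2_21 s2E // subn_eq0 -ltnNge.
case: ifP => _; last by split; [exists Z2|rewrite !s2E].
rewrite 2!run_seq !run_assign !eval_reg !setE /= s2_21 !s2E //; split=> //.
by exists Z2; do 3 apply: layout_setr => //.
Qed.

(** * Search for the best candidate *)

Definition search := LFor 14 7 (LFor 15 9 evaluate).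

(** The registers of the best candidate start at 0, so the candidate with these numbers has to
    respect every budget. *)
Lemma candidate00 p : candidate 0 0 p = false.
Proof.
have E : chain_of n 0 = [::] by rewrite /chain_of (eq_filter (a2 := pred0)) ?filter_pred0.
rewrite /candidate /= E /links /= orbF /take_bits; elim: (pairs n) => //= q l IHl.
by rewrite /take_bit /=; case: ifP.
Qed.

(** The recorded value is only a lower bound for the value of the recorded candidate, because it
    starts at 0. The bound by register 9 is what rebuilding this candidate requires. *)
Definition best_among (P : nat -> nat -> Prop) s := (exists Z, layout Z s) /\
  [/\ fits (reg s 23) (reg s 24), reg s 22 <= value (reg s 23) (reg s 24),
      reg s 24 <= reg s 9
    & forall w x, P w x -> fits w x -> value w x <= reg s 22].

Lemma best_among_setr P s r v : r \in [:: 14; 15] ->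
  best_among P s -> best_among P (setr s r v).
Proof.
move=> rP [[Z sZ] best]; split.
  by exists Z; apply: layout_setr sZ; move: rP; rewrite !inE => /orP[]/eqP->.
by move: rP; rewrite !inE !setE => /orP[]/eqP->.
Qed.

Lemma eq_best_among (P P' : nat -> nat -> Prop) s :
  (forall w x, P' w x -> P w x) -> best_among P s -> best_among P' s.
Proof. by move=> PP' [ex [? ? ? H]]; split=> //; split=> // w x /PP'; apply: H. Qed.

Lemma run_search s : layout pred0 s -> reg s 1 = B ->
    reg s 22 = 0 -> reg s 23 = 0 -> reg s 24 = 0 ->
  best_among (fun w x => w < reg s 7 /\ x < reg s 9) (run search s).
Proof.
move=> s0 s_B s22 s23 s24.
pose J k := best_among (fun w x => w < k /\ x < reg s 9).
apply: (@run_for _ _ _ _ J (best_among (fun w x => w < reg s 7 /\ x < reg s 9))).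
- split; first by exists pred0.
  rewrite s22 s23 s24; split=> //; last by move=> w x [].
  by rewrite /fits (eq_count (a2 := pred0)) ?count_pred0 // => p; apply: candidate00.
- move=> w st lt_w frame Jst; set st1 := setr st 14 w.
  have st1_B : reg st1 1 = B by rewrite /st1 setE /= frame.
  have st1_9 : reg st1 9 = reg s 9 by rewrite /st1 setE /= frame.
  (* The candidates seen so far are those lexicographically before [(w, k)]. *)
  pose K k := best_among (fun w' x' => (w' < w \/ w' = w /\ x' < k) /\ x' < reg s 9).
  apply: (@run_for _ _ _ _ K); rewrite ?st1_9.
  + apply: best_among_setr => //; apply: eq_best_among Jst => w' x' [[] //].
    by case.
  + move=> x st2 lt_x frame2 [[Z st2Z] [fits2 le2 bx2 max2]].
    have st2_9 : reg st2 9 = reg s 9 by rewrite frame2.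
    have st3Z : layout Z (setr st2 15 x) by apply: layout_setr.
    have [||ex] := run_evaluate st3Z.
    * by rewrite !setE /= st2_9 ltnW.
    * by rewrite setE /= frame2.
    have st4_9 : reg (run evaluate (setr st2 15 x)) 9 = reg s 9.
      by rewrite regE_writes // setE.
    rewrite !setE /= frame2 // /st1 setE /=; move: (run evaluate _) ex st4_9 => st4 ex st4_9.
    case: ifP => [/andP[fits_x lt_best] [st4_22 st4_23 st4_24]|not_better [st4_22 st4_23 st4_24]].
      split=> //; rewrite st4_22 st4_23 st4_24 st4_9; split=> //; first exact: ltnW.
      move=> w' x' [[lt_w'|[-> lt_x1]] lt_x'].
        by move=> /max2 le; apply: leq_trans (ltnW lt_best); apply: le; split=> //; left.
      move: lt_x1; rewrite ltnS leq_eqVlt => /predU1P[-> //|lt_x'x].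
      by move=> /max2 le; apply: leq_trans (ltnW lt_best); apply: le; split=> //; right.
    split=> //; rewrite st4_22 st4_23 st4_24 st4_9; split=> //; first by rewrite -st2_9.
    move=> w' x' [[lt_w'|[-> lt_x1]] lt_x'].
      by apply: max2; split=> //; left.
    move: lt_x1; rewrite ltnS leq_eqVlt => /predU1P[->|lt_x'x].
      by move: not_better => /negbT; rewrite negb_and => /orP[/negP//|]; rewrite -leqNgt.
    by apply: max2; split=> //; right.
  move=> st2 _ Kst2; apply: best_among_setr => //; apply: eq_best_among Kst2 => w' x' [lt_w' lt_x'].
  by split=> //; move: lt_w'; rewrite ltnS leq_eqVlt => /predU1P[->|]; [right|left].
by move=> st _; apply: best_among_setr.
Qed.

End Layout.

Local Arguments run : simpl never.

Section SetLayout.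
Variables (n : nat) (e : rel nat) (hi ho : pred nat) (Z : pred (nat * nat)) (s : state).
Variables (v u : nat).
Hypotheses (vn : v < n) (un : u < n) (sZ : layout n e hi ho Z s).

Lemma layout_set_edge (b : bool) :
  layout n (fun v' u' => if (v', u') == (v, u) then b else e v' u') hi ho Z
    (setm s (v * n + u) b).
Proof.
case: sZ => s0 s2 s3 s4 s5 mE mW mI mO mR; have := cell_bound vn un => lt_vu.
split=> // [v' u' vn' un'|v' u' vn' un'|v' vn'|v' vn'|v' vn']; rewrite memory_setm.
- by rewrite cell_inj // xpair_eqE; case: ifP => // _; rewrite mE.
- by rewrite (negbTE (_ : _ != _)) ?mW //; lia.
- by rewrite (negbTE (_ : _ != _)) ?mI //; lia.
- by rewrite (negbTE (_ : _ != _)) ?mO //; lia.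
- by rewrite (negbTE (_ : _ != _)) ?mR //; lia.
Qed.

Lemma layout_set_in :
  layout n e (fun u' => (u' == u) || hi u') ho Z (setm s ((n * n).*2 + u) 1).
Proof.
case: sZ => s0 s2 s3 s4 s5 mE mW mI mO mR.
split=> // [v' u' vn' un'|v' u' vn' un'|v' vn'|v' vn'|v' vn']; rewrite memory_setm.
- by rewrite (negbTE (_ : _ != _)) ?mE //; have := cell_bound vn' un'; lia.
- by rewrite (negbTE (_ : _ != _)) ?mW //; have := cell_bound vn' un'; lia.
- by rewrite eqn_add2l; case: eqP => // _; rewrite mI.
- by rewrite (negbTE (_ : _ != _)) ?mO //; lia.
- by rewrite (negbTE (_ : _ != _)) ?mR //; lia.
Qed.

Lemma layout_set_out :
  layout n e hi (fun v' => (v' == v) || ho v') Z (setm s ((n * n).*2 + n + v) 1).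
Proof.
case: sZ => s0 s2 s3 s4 s5 mE mW mI mO mR.
split=> // [v' u' vn' un'|v' u' vn' un'|v' vn'|v' vn'|v' vn']; rewrite memory_setm.
- by rewrite (negbTE (_ : _ != _)) ?mE //; have := cell_bound vn' un'; lia.
- by rewrite (negbTE (_ : _ != _)) ?mW //; have := cell_bound vn' un'; lia.
- by rewrite (negbTE (_ : _ != _)) ?mI //; lia.
- by rewrite eqn_add2l; case: eqP => // _; rewrite mO.
- by rewrite (negbTE (_ : _ != _)) ?mR //; lia.
Qed.

End SetLayout.

Definition copy := for_pairs (LStore (edge_addr 10 11) (work_at 10 11)).

Lemma run_copy n e hi ho Z s : layout n e hi ho Z s ->
  forall v u, v < n -> u < n -> memory (run copy s) (v * n + u) = Z (v, u).
Proof.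
move=> sZ.
pose J (l : seq (nat * nat)) st := exists2 e', layout n e' hi ho Z st &
  forall v u, (v, u) \in l -> e' v u = Z (v, u).
pose Q st := forall v u, v < n -> u < n -> memory st (v * n + u) = Z (v, u).
apply: (@run_for_pairs n _ _ J Q) => //.
- exact: layout_n sZ.
- by exists e.
- move=> l st v u vn un st10 st11 _ [e' stZ e'l].
  rewrite run_store (eval_edge_addr stZ) ?(eval_work_at stZ) ?st10 ?st11 //.
  exists (fun v' u' => if (v', u') == (v, u) then Z (v, u) else e' v' u').
    exact: layout_set_edge.
  by move=> v' u'; rewrite mem_rcons in_cons; case: eqP => [->|_ /= /e'l].
- move=> l st r k r_k [e' stZ e'l]; exists e' => //.
  by apply: layout_setr stZ; case/orP: r_k => /eqP->.
move=> st _ [e' stZ e'l] v u vn un; rewrite (memory_edge stZ) // e'l //.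
by rewrite mem_pairs /= vn.
Qed.

(** Only the numbers of the best candidate have been kept, so it is built anew before it overwrites
    the input. *)
Definition output :=
  LSeq (LAssign 14 (Reg 23)) (LSeq (LAssign 15 (Reg 24)) (LSeq build copy)).
Definition main := LSeq search output.

Lemma run_main n e hi ho B s : layout n e hi ho pred0 s -> reg s 1 = B ->
    reg s 22 = 0 -> reg s 23 = 0 -> reg s 24 = 0 ->
  exists w x, [/\ fits n hi ho B w x,
    forall w' x', w' < reg s 7 -> x' < reg s 9 -> fits n hi ho B w' x' ->
      value n e hi ho w' x' <= value n e hi ho w x
  & forall v u, v < n -> u < n ->
      memory (run main s) (v * n + u) = candidate n hi ho w x (v, u)].
Proof.
move=> s0 s_B s22 s23 s24.
have [[Z s1Z] [fits1 le1 bx1 max1]] := run_search s0 s_B s22 s23 s24.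
exists (reg (run search s) 23), (reg (run search s) 24); split=> //.
  by move=> w' x' lt_w' lt_x' fits'; apply: leq_trans (max1 _ _ _ fits') le1.
rewrite /main run_seq; move: (run search s) s1Z bx1 => {fits1 le1 max1} s1 s1Z bx1.
rewrite /output 3!run_seq !run_assign !eval_reg setE /=.
set s2 := setr _ 15 _.
have s2Z : layout n e hi ho Z s2 by do 2 apply: layout_setr => //.
have := run_build s2Z; rewrite /s2 !setE /= => /(_ bx1); exact: run_copy.
Qed.

(** * Tables and loop bounds *)

Definition set_rows :=
  LFor 10 0 (LSeq (LStore (Add (Reg 5) (Reg 10)) (Reg 6)) (LAssign 6 (Add (Reg 6) (Reg 0)))).
Definition set_bases :=
  LSeq (LFor 10 0 (LAssign 2 (Add (Reg 2) (Reg 0))))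
  (LSeq (LAssign 3 (Add (Reg 2) (Reg 2)))
  (LSeq (LAssign 4 (Add (Reg 3) (Reg 0)))
        (LAssign 5 (Add (Reg 4) (Reg 0))))).
Definition set_flags :=
  for_pairs (LIf (edge_at 10 11)
    (LSeq (LStore (Add (Reg 4) (Reg 10)) (Lit 1)) (LStore (Add (Reg 3) (Reg 11)) (Lit 1)))
    LSkip).
(** Sources and sinks are the vertices with exactly one of the two flags. Their count starts at 1 to
    make room for the end of the chain, and register 7 is [n + 1] because thresholds range from 0 to
    [n] inclusive. *)
Definition count_ends :=
  LSeq (LAssign 7 (Add (Reg 0) (Lit 1)))
  (LSeq (LAssign 8 (Lit 1))
     (LFor 10 0 (LIf (eq_test (in_flag 10) (out_flag 10)) LSkip
                   (LAssign 8 (Add (Reg 8) (Lit 1)))))).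
Definition setup := LSeq set_bases (LSeq set_rows (LSeq set_flags count_ends)).
Definition set_power :=
  LSeq (LAssign 9 (Lit 1)) (LFor 25 8 (LFor 26 8 (LAssign 9 (Add (Reg 9) (Reg 9))))).

Lemma run_set_bases n s (s' := run set_bases s) : reg s 0 = n -> reg s 2 = 0 ->
  [/\ reg s' 2 = n * n, reg s' 3 = (n * n).*2, reg s' 4 = (n * n).*2 + n
    & reg s' 5 = (n * n).*2 + n.*2].
Proof.
move=> s_n s2; rewrite /s' /set_bases 3!run_seq !run_assign.
set s1 := run (LFor _ _ _) _.
have s1_0 : reg s1 0 = n by rewrite regE_writes.
have s1_2 : reg s1 2 = n * n.
  apply: (@run_for _ _ _ _ (fun k st => reg st 2 = k * n) (fun st => reg st 2 = n * n)).
  - by rewrite s2.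
  - move=> k st _ frame st2; rewrite run_assign eval_add !eval_reg !reg_setr /= st2 mulSn addnC.
    by rewrite frame // s_n.
  - by move=> st _; rewrite setE /= s_n.
clearbody s1; rewrite !eval_add !eval_reg !reg_setr /= s1_0 s1_2 -!addnn.
by split; lia.
Qed.

Lemma run_set_rows n (e : rel nat) s : reg s 0 = n -> reg s 2 = n * n -> reg s 3 = (n * n).*2 ->
    reg s 4 = (n * n).*2 + n -> reg s 5 = (n * n).*2 + n.*2 -> reg s 6 = 0 ->
    (forall v u, v < n -> u < n -> memory s (v * n + u) = e v u) ->
    (forall a, n * n <= a -> memory s a = 0) ->
  layout n e pred0 pred0 pred0 (run set_rows s).
Proof.
move=> s0 s2 s3 s4 s5 s6 mE m0.
pose J k st := [/\ reg st 6 = k * n,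
  forall a, a < reg s 5 -> memory st a = memory s a
  & forall v, v < k -> memory st (reg s 5 + v) = v * n].
apply: (@run_for _ _ _ _ J); rewrite ?s0.
- by split.
- move=> k st lt_k frame [st6 st_lt st_row].
  rewrite run_seq run_store run_assign !eval_add !eval_reg reg_setm !reg_setr /=.
  rewrite !(frame 0) ?(frame 5) // s0 st6 /J !setE /= mulSn addnC; split=> //.
    by move=> a lt_a; rewrite memory_setm (ltn_eqF (ltn_addr _ lt_a)) setE st_lt.
  move=> v; rewrite ltnS leq_eqVlt memory_setm eqn_add2l => /predU1P[->|lt_v].
    by rewrite eqxx.
  by rewrite (ltn_eqF lt_v) setE st_row.
move=> st frame [_ st_lt st_row].
split=> [|||||v u vn un|v u vn un|v vn|v vn|v vn]; rewrite !setE /= ?frame //.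
- by rewrite st_lt ?mE // s5; have := cell_bound vn un; lia.
- by rewrite st_lt ?m0 // ?s5; have := cell_bound vn un; lia.
- by rewrite st_lt ?m0 // ?s5; lia.
- by rewrite st_lt ?m0 // ?s5; lia.
- by rewrite -s5 st_row.
Qed.

Lemma run_set_flags n e s : layout n e pred0 pred0 pred0 s ->
  layout n e (fun u => has (fun v => e v u) (iota 0 n))
             (fun v => has (fun u => e v u) (iota 0 n)) pred0 (run set_flags s).
Proof.
move=> s0; pose in_of (l : seq (nat * nat)) u := has (fun p => e p.1 p.2 && (p.2 == u)) l.
pose out_of (l : seq (nat * nat)) v := has (fun p => e p.1 p.2 && (p.1 == v)) l.
pose J l := layout n e (in_of l) (out_of l) pred0.
have eq_flags hi hi' ho ho' st : hi =1 hi' -> ho =1 ho' ->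
    layout n e hi ho pred0 st -> layout n e hi' ho' pred0 st.
  by move=> E E' [*]; split=> // v vn; rewrite -?E -?E'; auto.
apply: (@run_for_pairs n _ _ J (layout n e _ _ pred0)) => //.
- exact: layout_n s0.
- move=> l st v u vn un st10 st11 _ stl.
  have in_rcons u' : in_of (rcons l (v, u)) u' = e v u && (u == u') || in_of l u'.
    by rewrite /in_of has_rcons.
  have out_rcons v' : out_of (rcons l (v, u)) v' = e v u && (v == v') || out_of l v'.
    by rewrite /out_of has_rcons.
  rewrite run_if (eval_edge_at stl) ?st10 ?st11 // run_seq !run_store.
  case Evu: (e v u) => /=; last first.
    by apply: eq_flags stl => a; rewrite ?in_rcons ?out_rcons Evu.
  rewrite !setE st10 st11 (layout_in stl) (layout_out stl).
  apply: eq_flags (layout_set_in vn un (layout_set_out vn un stl)) => a.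
    by rewrite in_rcons Evu eq_sym.
  by rewrite out_rcons Evu eq_sym.
- move=> l st r k r_k stl; apply: layout_setr stl.
  by case/orP: r_k => /eqP->.
move=> st _ [s_n s2 s3 s4 s5 mE mW mI mO mR]; split=> // v vn; rewrite ?mI ?mO //.
  congr nat_of_bool; apply/hasP/hasP => [[[a b]]|[a]].
    by rewrite mem_pairs /= => /andP[an bn] /andP[eab /eqP <-]; exists a; rewrite ?mem_iota.
  by rewrite mem_iota => /= an eav; exists (a, v); rewrite ?mem_pairs /= ?an ?vn ?eav ?eqxx.
congr nat_of_bool; apply/hasP/hasP => [[[a b]]|[b]].
  by rewrite mem_pairs /= => /andP[an bn] /andP[eab /eqP <-]; exists b; rewrite ?mem_iota.
by rewrite mem_iota => /= bn evb; exists (v, b); rewrite ?mem_pairs /= ?bn ?vn ?evb ?eqxx.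
Qed.

Lemma run_count_ends n e hi ho Z s (s' := run count_ends s) : layout n e hi ho Z s ->
  [/\ layout n e hi ho Z s', reg s' 7 = n.+1
    & reg s' 8 = (count (fun v => hi v != ho v) (iota 0 n)).+1].
Proof.
move=> sZ; split; first by apply: layout_run.
  rewrite /s' /count_ends run_seq; rewrite regE_writes //.
  by rewrite run_assign !setE /= (layout_n sZ) addn1.
rewrite /s' /count_ends 2!run_seq !run_assign; set s1 := setr _ 8 _.
have s1Z : layout n e hi ho Z s1 by do 2 apply: layout_setr => //.
pose J k st := layout n e hi ho Z st /\
  reg st 8 = (count (fun v => hi v != ho v) (iota 0 k)).+1.
apply: (@run_for _ _ _ _ J (fun st => reg st 8 = _)); rewrite ?(layout_n s1Z).
- by split; rewrite // /s1 !setE.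
- move=> k st lt_k _ [stZ st8]; set st1 := setr st 10 k.
  have st1Z : layout n e hi ho Z st1 by apply: layout_setr.
  have st1_10 : reg st1 10 = k by rewrite /st1 setE.
  have st1_8 : reg st1 8 = reg st 8 by rewrite /st1 setE.
  rewrite run_if eval_eq_test (eval_in_flag st1Z) ?(eval_out_flag st1Z) ?st1_10 //.
  rewrite /J iota0S -cats1 count_cat /= addn0 run_assign.
  case: (hi k); case: (ho k) => /=; rewrite ?setE /= ?st1_8 ?st8 ?addn0 ?addn1; split=> //;
    by apply: layout_setr.
by move=> st _ [_]; rewrite setE.
Qed.

Lemma run_setup n (e : rel nat) s (s' := run setup s)
    (hi := fun u => has (fun v => e v u) (iota 0 n))
    (ho := fun v => has (fun u => e v u) (iota 0 n)) :
    reg s 0 = n -> reg s 2 = 0 -> reg s 6 = 0 ->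
    (forall v u, v < n -> u < n -> memory s (v * n + u) = e v u) ->
    (forall a, n * n <= a -> memory s a = 0) ->
  [/\ layout n e hi ho pred0 s', reg s' 7 = n.+1
    & reg s' 8 = (count (fun v => hi v != ho v) (iota 0 n)).+1].
Proof.
move=> s0 s2 s6 mE m0; rewrite /s' /setup 3!run_seq.
have [s1_2 s1_3 s1_4 s1_5] := run_set_bases s0 s2.
apply/run_count_ends/run_set_flags/run_set_rows => //; rewrite ?regE_writes //.
  by move=> v u vn un; rewrite memory_storeless // mE.
by move=> a le_a; rewrite memory_storeless // m0.
Qed.

Lemma run_set_power s : reg (run set_power s) 9 = 2 ^ (reg s 8 * reg s 8).
Proof.
rewrite /set_power run_seq run_assign; set s1 := setr s 9 _; set K := reg s 8.
have s1_8 : reg s1 8 = K by rewrite /s1 setE.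
apply: (@run_for _ _ _ _ (fun k st => reg st 9 = 2 ^ (k * K)) (fun st => reg st 9 = _)).
- by rewrite /s1 setE.
- move=> k st _ frame st9; set st1 := setr st 25 k.
  have st1_8 : reg st1 8 = K by rewrite /st1 setE /= frame.
  apply: (@run_for _ _ _ _ (fun l st => reg st 9 = 2 ^ (k * K + l)) (fun st => reg st 9 = _)).
  + by rewrite /st1 setE addn0.
  + by move=> l st2 _ _ st2_9; rewrite run_assign eval_add !eval_reg !reg_setr /= st2_9 addnS expnS mul2n addnn.
  + by move=> st2 _; rewrite setE /= st1_8 mulSn addnC.
by move=> st _; rewrite setE /= s1_8.
Qed.

(** * Correctness and running time *)

Lemma mem_zip_map (S T : eqType) (f : S -> T) s t a b : injective f ->
  ((f a, f b) \in zip (map f s) (map f t)) = ((a, b) \in zip s t).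
Proof.
move=> f_inj; elim: s t => [|x s IHs] [|y t] //=.
by rewrite !in_cons IHs !xpair_eqE !(inj_eq f_inj).
Qed.

Lemma take_bits_cand hi ho c x l p : p \in (take_bits hi ho c x l).2 -> cand_nat hi ho c p.
Proof.
elim/last_ind: l => // l q IHl; rewrite take_bits_rcons /take_bit.
case: ifP => // cq; case: ifP => //= _.
by rewrite in_cons => /predU1P[->|].
Qed.

(** The lowest digit belongs to the first admissible pair, so the number is built from the end of
    the list, with one doubling per admissible pair. *)
Lemma take_bits_surj hi ho c (Z : pred (nat * nat)) l :
  exists2 x, x < 2 ^ count (cand_nat hi ho c) l &
    forall p, (p \in (take_bits hi ho c x l).2) = [&& p \in l, cand_nat hi ho c p & Z p].
Proof.
(* The selected pairs pile up in an accumulator, over which the induction has to be general. *)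
suff H A : exists2 x, x < 2 ^ count (cand_nat hi ho c) l &
    forall p, (p \in (foldl (take_bit hi ho c) (x, A) l).2) =
              (p \in A) || [&& p \in l, cand_nat hi ho c p & Z p].
  by have [x lt_x xP] := H [::]; exists x.
elim: l A => [|q l IHl] A /=; first by exists 0 => // p; rewrite orbF.
rewrite /take_bit; case cq: (cand_nat hi ho c q) => /=; last first.
  have [x lt_x xP] := IHl A; exists x => // p; rewrite xP in_cons.
  by case: eqP => // ->; rewrite cq /= andbF.
have [x lt_x xP] := IHl (if Z q then q :: A else A).
exists (Z q + x.*2); first by rewrite expnS; case: (Z q) => /=; lia.
move=> p; rewrite half_bit_double oddD odd_double addbF oddb xP in_cons.
case Zq: (Z q); rewrite ?in_cons; case: eqP => [->|_] //=; by rewrite ?cq ?Zq ?andbF ?orbT.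
Qed.

Lemma count_iota (P : pred nat) n : count P (iota 0 n) = #|[set v : 'I_n | P v]|.
Proof.
rewrite -val_enum_ord count_map -size_filter cardsE cardE /enum_mem -filter_predI.
by congr (size _); apply: eq_filter => v /=; rewrite !inE andbT.
Qed.

Lemma chain_of_le hi ho n w : w <= n ->
  chain_of hi ho n w = [seq v <- iota 0 w | isolated_nat hi ho v].
Proof.
move=> le_w; rewrite /chain_of -{1}(subnKC le_w) iotaD filter_cat add0n.
rewrite [X in _ ++ X](eq_in_filter (a2 := pred0)) ?filter_pred0 ?cats0.
  by apply: eq_in_filter => v; rewrite mem_iota /= => ->.
by move=> v; rewrite mem_iota => /andP[le_v _]; rewrite ltnNge le_v.
Qed.

(** The count grows by at most one with each number, so no value is skipped: chains of all lengths
    arise from thresholds. *)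
Lemma count_iota_onto (P : pred nat) n r : r <= count P (iota 0 n) ->
  exists2 w, w <= n & count P (iota 0 w) = r.
Proof.
elim: n => [|n IHn]; first by rewrite leqn0 => /eqP->; exists 0.
case: (leqP r (count P (iota 0 n))) => [/IHn[w le_w <-] _|lt_r].
  by exists w => //; apply: leqW.
rewrite iota0S -cats1 count_cat /= addn0 => le_r; exists n.+1 => //.
by rewrite iota0S -cats1 count_cat /= addn0; move: le_r; case: (P n) => /=; lia.
Qed.

(** * The candidates of an instance *)

Section Instance.
Variable x : mci_instance.
Let n := nb_vertices x.
Let E := edges x.
Let k := mci_param x.
Let B := budget x.

Definition edge_nat : rel nat := fun v u =>
  [exists p in E, (val p.1 == v) && (val p.2 == u)].
Let hi u := has (fun v => edge_nat v u) (iota 0 n).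
Let ho v := has (fun u => edge_nat v u) (iota 0 n).

Lemma edge_natE (v u : 'I_n) : edge_nat v u = ((v, u) \in E).
Proof.
apply/existsP/idP => [[[a b] /and3P[Eab /eqP/val_inj <- /eqP/val_inj <-]] //|Evu].
by exists (v, u); rewrite Evu !eqxx.
Qed.

Lemma has_iotaE (P : pred nat) : has P (iota 0 n) = [exists v : 'I_n, P v].
Proof.
apply/hasP/existsP => [[v]|[v Pv]]; last by exists (val v); rewrite ?mem_iota /=.
by rewrite mem_iota /= => vn Pv; exists (Ordinal vn).
Qed.

Lemma hiE (v : 'I_n) : hi v = ~~ no_in E v.
Proof.
rewrite /hi has_iotaE /no_in negb_forall; apply: eq_existsb => u.
by rewrite negbK edge_natE.
Qed.

Lemma hoE (v : 'I_n) : ho v = ~~ no_out E v.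
Proof.
rewrite /ho has_iotaE /no_out negb_forall; apply: eq_existsb => u.
by rewrite negbK edge_natE.
Qed.

Lemma sourcesE : sources E = [set v | no_in E v && ~~ no_out E v].
Proof.
apply/setP=> v; rewrite !inE; congr (_ && _); rewrite negb_forall.
by apply: eq_existsb => u; rewrite negbK.
Qed.

Lemma sinksE : sinks E = [set v | no_out E v && ~~ no_in E v].
Proof.
apply/setP=> v; rewrite !inE; congr (_ && _); rewrite negb_forall.
by apply: eq_existsb => u; rewrite negbK.
Qed.

Lemma count_ends_param : count (fun v => hi v != ho v) (iota 0 n) = k.
Proof.
rewrite count_iota /k /mci_param -/E -cardsUI [X in _ = _ + X](_ : _ = 0) ?addn0.
  apply: eq_card => v; rewrite sourcesE sinksE !inE hiE hoE.
  by case: (no_in E v); case: (no_out E v).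
apply/eqP; rewrite cards_eq0 -subset0; apply/subsetP=> v.
by rewrite sourcesE sinksE !inE; case: (no_in E v); rewrite ?andbF.
Qed.

Lemma memory_encode v u : v < n -> u < n ->
  memory (mci_encode x) (v * n + u) = edge_nat v u.
Proof.
move=> vn un; rewrite /=; congr nat_of_bool; apply: eq_existsb => -[a b].
by congr (_ && _); rewrite /cell -/n cell_inj.
Qed.

Lemma memory_encode0 a : n * n <= a -> memory (mci_encode x) a = 0.
Proof.
move=> le_a; rewrite /= (_ : [exists p in _, _] = false) //.
apply/negbTE/existsPn=> -[v u]; rewrite negb_and; apply/orP; right.
by apply: contraL le_a => /eqP<-; rewrite -ltnNge; apply: cell_bound.
Qed.

Definition candidate_set w y : {set 'I_n * 'I_n} :=
  [set p | candidate n hi ho w y (val p.1, val p.2)].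

Definition ord_chain w : seq 'I_n := [seq v : 'I_n <- enum 'I_n | (val v < w) && isolated E v].

Lemma isolated_natE (v : 'I_n) : isolated_nat hi ho v = isolated E v.
Proof. by rewrite /isolated_nat hiE hoE !negbK. Qed.

Lemma chain_ofE w : chain_of hi ho n w = map val (ord_chain w).
Proof.
rewrite /chain_of -val_enum_ord filter_map; congr map; apply: eq_filter => v /=.
by rewrite isolated_natE.
Qed.

Lemma linksE w (a b : 'I_n) :
  links (chain_of hi ho n w) (val a, val b) = ((a, b) \in path_edges (ord_chain w)).
Proof. by rewrite chain_ofE /links inE behead_map mem_zip_map //; apply: val_inj. Qed.

Lemma cand_natE w (a b : 'I_n) :
  cand_nat hi ho (chain_of hi ho n w) (val a, val b) = chain_cand E (ord_chain w) (a, b).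
Proof.
have tailE : chain_tail (chain_of hi ho n w) (val a) = chain_tail (ord_chain w) a.
  by rewrite chain_ofE; case: (ord_chain w) => //= c0 c; rewrite last_map val_eqE.
have headE : chain_head (chain_of hi ho n w) (val b) = chain_head (ord_chain w) b.
  by rewrite chain_ofE; case: (ord_chain w).
rewrite /cand_nat /chain_cand /= tailE headE !hiE !hoE !negbK /isolated.
by case: (no_out E a); case: (no_in E b); rewrite //= ?andbT ?implybE //;
   case: (no_in E a); case: (no_out E b).
Qed.

(** Together with [feasible_no_out] this makes every candidate disjoint from [E], so that the
    program has to check the budget only. *)
Lemma candidate_no_out w y e : e \in candidate_set w y -> no_out E e.1.
Proof.
case: e => a b; rewrite inE /candidate /= => /orP[/take_bits_cand|].
  by rewrite cand_natE => /and4P[].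
rewrite linksE inE => /mem_zip/andP[].
by rewrite mem_filter => /andP[/andP[_ /andP[_]]].
Qed.

Lemma card_candidate w y : count (candidate n hi ho w y) (pairs n) = #|candidate_set w y|.
Proof. exact: count_pairs. Qed.

Lemma value_connectivity w y :
  value n edge_nat hi ho w y = connectivity (E :|: candidate_set w y).
Proof.
rewrite /value /connectivity; apply: eq_card => p; rewrite !inE.
by apply: eq_connect => a b; rewrite /candidate_graph /adj !inE edge_natE.
Qed.

(** An admissible pair goes from a sink or the last vertex of the chain to a source or the first
    vertex; either side has at most [k + 1] choices. *)
Lemma count_cand w : count (cand_nat hi ho (chain_of hi ho n w)) (pairs n) <= k.+1 * k.+1.
Proof.
pose T := sinks E :|: [set v | chain_tail (ord_chain w) v].
pose S := sources E :|: [set v | chain_head (ord_chain w) v].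
have le1 (P : pred 'I_n) : (forall a b, P a -> P b -> a = b) -> #|[set v | P v]| <= 1.
  by move=> P1; apply/card_le1_eqP => a b; rewrite !inE => Pa Pb; apply: P1.
have cardT : #|T| <= k.+1.
  rewrite -addn1; apply: leq_trans (leq_card_setU _ _) (leq_add (leq_addl _ _) (le1 _ _)).
  by case: (ord_chain w) => //= a c v u /eqP-> /eqP->.
have cardS : #|S| <= k.+1.
  rewrite -addn1; apply: leq_trans (leq_card_setU _ _) (leq_add (leq_addr _ _) (le1 _ _)).
  by case: (ord_chain w) => //= a c v u /eqP-> /eqP->.
rewrite count_pairs; apply: leq_trans (leq_mul cardT cardS); rewrite -cardsX.
apply/subset_leq_card/subsetP=> -[a b]; rewrite inE cand_natE /chain_cand /isolated /=.
case/and4P=> a_out b_in; rewrite a_out b_in andbT /= => aP bP.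
apply/setXP; rewrite !in_setU sinksE sourcesE !inE a_out b_in.
by split; [case: (no_in E a) aP | case: (no_out E b) bP].
Qed.

(** A threshold [w] cuts off a chain of the length demanded by [chain_optimal], and the digits of
    [y] spell out the other edges of the solution. *)
Lemma candidates_complete :
  exists w y, [/\ w < n.+1, y < 2 ^ (k.+1 * k.+1), fits n hi ho B w y
                & mci_optimal E B (candidate_set w y)].
Proof.
have [r le_r optP] := chain_optimal B (@edges_acyclic x).
have [w le_w def_r] : exists2 w, w <= n & count (isolated_nat hi ho) (iota 0 w) = r.
  apply: count_iota_onto; rewrite count_iota; apply: leq_trans le_r _.
  by apply/subset_leq_card/subsetP=> v; rewrite !inE isolated_natE.
have [||N [Nopt pathN Nsub]] := optP (ord_chain w) (filter_uniq _ (enum_uniq _)).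
- by apply/allP=> v; rewrite mem_filter => /andP[/andP[]].
- by rewrite -(size_map val) -chain_ofE chain_of_le // size_filter.
pose Z (p : nat * nat) := [exists q in N, p == (val q.1, val q.2)].
have ZE (a b : 'I_n) : Z (val a, val b) = ((a, b) \in N).
  apply/existsP/idP => [[[c d] /andP[Ncd]]|Nab]; last by exists (a, b); rewrite Nab /=.
  by rewrite xpair_eqE => /andP[/eqP/val_inj-> /eqP/val_inj->].
have [y lt_y yP] := take_bits_surj hi ho (chain_of hi ho n w) Z (pairs n).
have defN : candidate_set w y = N.
  apply/setP=> -[a b]; rewrite inE /candidate /= yP linksE cand_natE ZE mem_pairs /= !ltn_ord /=.
  apply/orP/idP => [[/andP[]//|/(subsetP pathN)//]|Nab].
  by case/orP: (Nsub _ Nab) => [|cand_ab]; [right|left; rewrite cand_ab Nab].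
exists w, y; split=> //; last by rewrite defN.
- by apply: leq_trans lt_y _; rewrite leq_pexp2l ?count_cand.
- by rewrite /fits card_candidate defN; case: Nopt => -[].
Qed.

(** The pieces are compiled separately because each computes loop bounds of later ones: their
    composition as a single bounded-loop program would not be [steady]. *)
Definition mci_program : cmd := Seq (compile setup) (Seq (compile set_power) (compile main)).

Definition program_weight := weight setup + (weight set_power + weight main).
Definition program_depth := maxn (depth setup) (maxn (depth set_power) (depth main)).

(* All loop bounds are at most (n + 1) * 2 ^ ((k + 1) ^ 2). *)
Lemma mci_program_run : exists t s,
  [/\ exec mci_program (mci_encode x) t s,
      t <= program_weight * ((n.+1) * 2 ^ (k.+1 * k.+1)) ^ program_depth
    & mci_solved x s].
Proof.
set s0 := mci_encode x; set s1 := run setup s0; set s2 := run set_power s1.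
have [||||| s1Z s1_7] := @run_setup n edge_nat s0; try by [].
- exact: memory_encode.
- exact: memory_encode0.
rewrite -/s1 -/hi -/ho count_ends_param => s1_8.
have s2Z : layout n edge_nat hi ho pred0 s2 by apply: layout_run.
have s2_9 : reg s2 9 = 2 ^ (k.+1 * k.+1) by rewrite run_set_power s1_8.
have s2_7 : reg s2 7 = n.+1 by rewrite regE_writes.
have [t0 exec0 le0] := @exec_compile setup s0 isT.
have [t1 exec1 le1] := @exec_compile set_power s1 isT.
have [t2 exec2 le2] := @exec_compile main s2 isT.
exists (t0 + (t1 + t2)), (run main s2); split.
- exact: ExecSeq exec0 (ExecSeq exec1 exec2).
- set X := 2 ^ _; set M := n.+1 * X.
  have X_gt0 : 0 < X by rewrite expn_gt0.
  have M_gt0 : 0 < M by rewrite muln_gt0.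
  have le_nM : n.+1 <= M by rewrite leq_pmulr.
  have le_XM : X <= M by rewrite leq_pmull.
  have le_kX : k.+1 <= X.
    apply: leq_trans (ltnW (ltn_expl k.+1 (isT : 1 < 2))) _.
    by rewrite leq_pexp2l // leq_pmulr.
  have bound p m : (forall b, b \in bounds p -> m b <= M) -> depth p <= program_depth ->
      time m p <= weight p * M ^ program_depth.
    move=> mM le_p; apply: leq_trans (leq_time M_gt0 mM) _.
    by rewrite leq_mul2l leq_pexp2l ?orbT.
  rewrite /program_weight mulnDl [X in _ <= _ + X]mulnDl; apply: leq_add; last apply: leq_add.
  + apply: leq_trans le0 (bound _ _ _ _); last exact: leq_maxl.
    move=> b; rewrite (_ : bounds setup = [:: 0; 0; 0; 0; 0]) // !inE !orbb => /eqP->.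
    exact: ltnW le_nM.
  + apply: leq_trans le1 (bound _ _ _ _); last by rewrite !leq_max leqnn orbT.
    move=> b; rewrite (_ : bounds set_power = [:: 8; 8]) // !inE !orbb => /eqP->.
    by rewrite s1_8; exact: leq_trans le_kX le_XM.
  + apply: leq_trans le2 (bound _ _ _ _); last by rewrite !leq_max leqnn !orbT.
    have /allP sub : all (mem [:: 0; 7; 9]) (bounds main) by [].
    move=> b /sub; rewrite /= !inE => /or3P[] /eqP->.
    * by rewrite (layout_n s2Z) ltnW.
    * by rewrite s2_7.
    * by rewrite s2_9.
have s2_B : reg s2 1 = B by rewrite !regE_writes.
have s2_22 : reg s2 22 = 0 by rewrite !regE_writes.
have s2_23 : reg s2 23 = 0 by rewrite !regE_writes.
have s2_24 : reg s2 24 = 0 by rewrite !regE_writes.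
have [w [y [fits_wy max_wy mem_wy]]] := run_main s2Z s2_B s2_22 s2_23 s2_24.
rewrite s2_7 s2_9 in max_wy.
have -> : mci_solved x (run main s2) = mci_optimal E B (candidate_set w y).
  congr (mci_optimal _ _ _); apply/setP=> -[a b]; rewrite !inE /cell /= -/n mem_wy //.
  by case: candidate.
(* The search yields a maximum among candidates only; an optimal candidate within its range extends
   this to all feasible sets. *)
have [w' [y' [lt_w' lt_y' fits' [_ opt']]]] := candidates_complete.
split.
  by apply: feasible_no_out; [apply: candidate_no_out | rewrite -card_candidate].
move=> N' /opt' le_N'; apply: leq_trans le_N' _.
by rewrite -!value_connectivity; apply: max_wy.
Qed.

End Instance.

(** What remains of the time bound once the power of [n + 1] is split off. *)
Definition time_factor (k : nat) :=
  program_weight * 2 ^ (k.+1 * (k.+1 * program_depth)).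

Lemma computable_time_factor : computable time_factor.
Proof.
(* The nested loops follow the product in the exponent: they double register 0, initially
   [program_weight], once for each unit of it. *)
pose loops := LFor 3 1 (LFor 4 1 (LFor 5 2 (LAssign 0 (Add (Reg 0) (Reg 0))))).
exists (Seq (Assign 1 (Add (Reg 0) (Lit 1)))
       (Seq (Assign 2 (Lit program_depth))
       (Seq (Assign 0 (Lit program_weight)) (compile loops)))) => k.
set s0 := State _ _.
have exec_assign r e s : exists t, exec (Assign r e) s t (setr s r (eval s e)).
  by exists (cost e).+1; apply: ExecAssign.
set s1 := setr s0 1 (eval s0 (Add (Reg 0) (Lit 1))).
set s2 := setr s1 2 (eval s1 (Lit program_depth)).
set s3 := setr s2 0 (eval s2 (Lit program_weight)).
have [t1 exec1] := exec_assign 1 (Add (Reg 0) (Lit 1)) s0.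
have [t2 exec2] := exec_assign 2 (Lit program_depth) s1.
have [t3 exec3] := exec_assign 0 (Lit program_weight) s2.
have [t4 exec4 _] := @exec_compile loops s3 isT.
exists (t1 + (t2 + (t3 + t4))), (run loops s3); split.
  exact: ExecSeq exec1 (ExecSeq exec2 (ExecSeq exec3 exec4)).
have s3_1 : reg s3 1 = k.+1 by rewrite /s3 /s2 /s1 !reg_setr /= addn1.
have s3_2 : reg s3 2 = program_depth by rewrite /s3 /s2 !reg_setr.
have s3_0 : reg s3 0 = program_weight by rewrite /s3 reg_setr.
pose f m st := reg st 0 = program_weight * 2 ^ m.
rewrite /time_factor; change (f (k.+1 * (k.+1 * program_depth)) (run loops s3)).
apply: (@run_for _ _ _ _ (fun i => f (i * (k.+1 * program_depth)))); rewrite ?s3_1.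
- by rewrite /f muln1.
- move=> i st _ frame fi; set st1 := setr st 3 i.
  have [st1_1 st1_2] : reg st1 1 = k.+1 /\ reg st1 2 = program_depth.
    by rewrite /st1 !reg_setr /= !frame.
  apply: (@run_for _ _ _ _ (fun j => f (i * (k.+1 * program_depth) + j * program_depth)));
    rewrite ?st1_1.
  + by rewrite addn0 /f /st1 reg_setr.
  + move=> j st2 _ frame2 fj; set st3 := setr st2 4 j.
    have st3_2 : reg st3 2 = program_depth by rewrite /st3 reg_setr /= frame2.
    apply: (@run_for _ _ _ _
      (fun l => f (i * (k.+1 * program_depth) + j * program_depth + l))); rewrite ?st3_2.
    * by rewrite addn0 /f /st3 reg_setr.
    * move=> l st4 _ _ fl; rewrite /f run_assign eval_add !eval_reg !reg_setr /= fl.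
      by rewrite addnS expnS; lia.
    * by move=> st4 _ fl; rewrite /f reg_setr [j.+1 * _]mulSnr addnA.
  + by move=> st2 _ fj; rewrite /f reg_setr [i.+1 * _]mulSnr.
by move=> st _ fi; rewrite /f reg_setr.
Qed.

Theorem theorem3 : fpt mci_encode nb_vertices mci_param mci_solved.
Proof.
exists mci_program, time_factor, program_depth; split=> [|x].
  exact: computable_time_factor.
have [t [s [exec_s le_t solved_s]]] := mci_program_run x.
exists t, s; split=> //; apply: leq_trans le_t _.
by rewrite /time_factor [_.+1 * (_ * _)]mulnA [2 ^ (_ * program_depth)]expnM expnMn
  -[leqRHS]mulnA [_ ^ _ * _ ^ _ in leqRHS]mulnC.
Qed.
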